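(* Let $S=\{z\in\mathbb C : |\mathrm{Im}(z)|<\pi\}$ and let $\theta$ be a function holomorphic in $S$ such that $|\theta(z)|<1$ for all $z\in S$ and $\theta(\mathbb R)\subset\mathbb R$. Put $$g_1=\frac12\,\frac{1-4\theta'(0)-\theta(0)^2}{1-\theta(0)^2}\in[0,1].$$ Assume that there exists a non-zero $\tau\in\mathbb R$ such that $\theta(\tau)=\theta(0)$. Then $g_1(1-g_1)\neq0$ and $$|\tau|\ \ge\ 2\left|\log\frac{1-g_1}{g_1}\right|.$$
   Context: The number $g_1$ is the first coefficient in the representation $\theta(z)=1-\dfrac{2}{\mu e^{z/2}g(e^z-1)+1}$, $z\in S$, where $\mu=\frac{1+\theta(0)}{1-\theta(0)}$ and $g(w)=\cfrac{1}{1+\cfrac{g_1w}{1+\cfrac{(1-g_1)g_2w}{1+\cdots}}}$ is a continued $g$-fraction with all $g_k\in[0,1]$; it is given by the explicit formula in the claim. *)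

(* Defs.v *)
From Stdlib Require Import Reals.
From Coquelicot Require Import Coquelicot.

Open Scope R_scope.

Definition strip (z : C) : Prop := Rabs (Im z) < PI.

(* Complex differentiability at every point of [D]; this is the usual notion
   when [D] is open, as [strip] is. *)
Definition holomorphic_on (D : C -> Prop) (f : C -> C) : Prop :=
  forall z : C, D z -> @ex_derive C_AbsRing C_NormedModule f z.

(* Complex-valued because [theta] is; that it is real is a consequence of
   [theta] being holomorphic near 0 and real on the real axis. *)
Definition g1_coeff (theta : C -> C) : C :=
  (/ 2 * ((1 - 4 * C_derive theta 0 - theta 0 ^ 2) / (1 - theta 0 ^ 2)))%C.

(* Main.v *)
(* The function T(z) = tanh(z/4) maps the strip conformally onto the unit disc,
   with T(0) = 0 and T'(0) = 1/4.  Put a = theta(0) and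
   F = (theta - a)/(1 - a theta), so that |F| <= 1 and F(0) = 0.  By the Schwarz
   lemma, F/T is bounded by 1, and its value b = 4 theta'(0)/(1 - a^2) at 0
   satisfies |b| <= 1; moreover g_1 = (1 - b)/2.  If theta(tau) = theta(0), then F
   also vanishes at tau, so that F(z)/(T(z) T(z - tau)) is bounded by 1 as well.
   At z = 0 this gives |b| <= |tanh(tau/4)|, that is
   2 |log((1 + b)/(1 - b))| <= |tau|.

   The maximum principle behind both bounds comes from Goursat's theorem on
   rectangles: if K is bounded by B on the boundary of a rectangle, then integrating
   K^n(z)/z along it gives |K(0)|^n <= const * B^n for all n, hence |K(0)| <= B. *)
Require Import Defs.
From Stdlib Require Import Reals Lra Lia Psatz Classical ClassicalEpsilon.
From Coquelicot Require Import Coquelicot.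

Open Scope R_scope.

(** * Limits and derivatives *)

(** By the addition formula for tanh, T(z - tau) is the Blaschke factor (T(z) - T(tau)) / (1 -
    T(tau) T(z)). Dividing by T(z) T(z - tau) is thus the two-point Schwarz lemma of the disc,
    transported to the strip without inverting T. The quotients K have no meaningful value at 0 and
    tau and are never extended there. A limit at each point is enough: z K^n(z)/z tends to K(0)^n at
    0, and (z - tau) K^n(z)/z tends to 0 at tau. Two losses have to be absorbed. The length of the
    contour, the bound on 1/|z| and the integral of 1/z contribute constants; these do not depend on
    n, so they disappear on taking n-th roots, and the integral of 1/z only has to be non-zero.
    Moreover |T| merely tends to 1 towards the edges and ends of the strip, so on large rectangles
    |K| is bounded only by some B > 1; B goes to 1 at the end. The strict inequality |tanh(tau/4)| <
    1 is what excludes g_1 = 0 and g_1 = 1. *)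

(* Epsilon-delta notions, because Coquelicot's product rule lives on [C_AbsRing],
   whose uniform structure is not that of [C_NormedModule]. *)
Definition clim (f : C -> C) (p L : C) : Prop :=
  forall eps : R, 0 < eps -> exists d : R, 0 < d /\
    forall z : C, z <> p -> Cmod (z - p) < d -> Cmod (f z - L) < eps.

Definition cderiv (f : C -> C) (z l : C) : Prop :=
  clim (fun w => ((f w - f z) / (w - z))%C) z l.

Lemma clim_const (k p : C) : clim (fun _ => k) p k.
Proof.
  intros eps He; exists 1; split; [lra|]; intros z _ _.
  replace (k - k)%C with (RtoC 0) by ring. now rewrite Cmod_0.
Qed.

Lemma clim_id (p : C) : clim (fun z => z) p p.
Proof. intros eps He; exists eps; split; auto. Qed.

Lemma clim_ext (f g : C -> C) (p L : C) (d0 : R) :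
  0 < d0 -> (forall z, z <> p -> Cmod (z - p) < d0 -> f z = g z) ->
  clim f p L -> clim g p L.
Proof.
  intros Hd0 Hfg Hf eps He; destruct (Hf eps He) as [d [Hd H]].
  exists (Rmin d d0); split; [now apply Rmin_pos|]; intros z Hz Hzp.
  rewrite <- Hfg; [apply H| |]; auto.
  - apply Rlt_le_trans with (1 := Hzp); apply Rmin_l.
  - apply Rlt_le_trans with (1 := Hzp); apply Rmin_r.
Qed.

Lemma clim_ext_all (f g : C -> C) (p L : C) :
  (forall z, z <> p -> f z = g z) -> clim f p L -> clim g p L.
Proof. intros H; apply (clim_ext f g p L 1 Rlt_0_1); auto. Qed.

Lemma clim_plus (f g : C -> C) (p L M : C) :
  clim f p L -> clim g p M -> clim (fun z => f z + g z)%C p (L + M)%C.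
Proof.
  intros Hf Hg eps He.
  destruct (Hf (eps / 2)) as [d1 [Hd1 H1]]; [lra|].
  destruct (Hg (eps / 2)) as [d2 [Hd2 H2]]; [lra|].
  exists (Rmin d1 d2); split; [now apply Rmin_pos|]; intros z Hz Hzp.
  specialize (H1 z Hz (Rlt_le_trans _ _ _ Hzp (Rmin_l _ _))).
  specialize (H2 z Hz (Rlt_le_trans _ _ _ Hzp (Rmin_r _ _))).
  replace (f z + g z - (L + M))%C with ((f z - L) + (g z - M))%C by ring.
  apply Rle_lt_trans with (1 := Cmod_triangle _ _); lra.
Qed.

Lemma clim_mult (f g : C -> C) (p L M : C) :
  clim f p L -> clim g p M -> clim (fun z => f z * g z)%C p (L * M)%C.
Proof.
  intros Hf Hg eps He.
  pose proof (Cmod_ge_0 L) as HL; pose proof (Cmod_ge_0 M) as HM.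
  (* The three products in the expansion of the error are bounded by e e, e |M| and |L| e; since e
     <= 1, they add up to at most e K. *)
  set (K := Cmod L + Cmod M + 1).
  assert (HK : 0 < K) by (unfold K; lra).
  assert (He' : 0 < Rmin 1 (eps / K)).
  { apply Rmin_pos; [lra|]; now apply Rdiv_lt_0_compat. }
  destruct (Hf _ He') as [d1 [Hd1 H1]].
  destruct (Hg _ He') as [d2 [Hd2 H2]].
  exists (Rmin d1 d2); split; [now apply Rmin_pos|]; intros z Hz Hzp.
  specialize (H1 z Hz (Rlt_le_trans _ _ _ Hzp (Rmin_l _ _))).
  specialize (H2 z Hz (Rlt_le_trans _ _ _ Hzp (Rmin_r _ _))).
  replace (f z * g z - L * M)%C
    with ((f z - L) * (g z - M) + ((f z - L) * M + L * (g z - M)))%C by ring.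
  pose proof (Cmod_ge_0 (f z - L)) as Hu; pose proof (Cmod_ge_0 (g z - M)) as Hv.
  pose proof (Rmin_l 1 (eps / K)); pose proof (Rmin_r 1 (eps / K)).
  set (e := Rmin 1 (eps / K)) in *.
  assert (HeK : e * K <= eps).
  { apply Rle_trans with (eps / K * K); [apply Rmult_le_compat_r; lra|].
    right; field; lra. }
  apply Rle_lt_trans with (1 := Cmod_triangle _ _).
  apply Rle_lt_trans with (Cmod (f z - L) * Cmod (g z - M)
     + (Cmod (f z - L) * Cmod M + Cmod L * Cmod (g z - M))).
  { rewrite Cmod_mult; apply Rplus_le_compat_l.
    rewrite <- !Cmod_mult; apply Cmod_triangle. }
  apply Rlt_le_trans with (e * K); [unfold K|lra].
  nra.
Qed.

Lemma clim_inv (f : C -> C) (p L : C) :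
  L <> 0 -> clim f p L -> clim (fun z => / f z)%C p (/ L)%C.
Proof.
  intros HL Hf eps He.
  assert (Hl : 0 < Cmod L) by now apply Cmod_gt_0.
  (* The first bound keeps |f z| above |L| / 2; the second then makes |f z - L| / (|f z| |L|)
     smaller than eps. *)
  set (e := Rmin (Cmod L / 2) (eps * (Cmod L * Cmod L / 2))).
  assert (He' : 0 < e).
  { apply Rmin_pos; [lra|]; apply Rmult_lt_0_compat; [lra|]; nra. }
  destruct (Hf e He') as [d [Hd H]].
  exists d; split; [easy|]; intros z Hz Hzp; specialize (H z Hz Hzp).
  pose proof (Rmin_l (Cmod L / 2) (eps * (Cmod L * Cmod L / 2))) as E1.
  pose proof (Rmin_r (Cmod L / 2) (eps * (Cmod L * Cmod L / 2))) as E2.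
  fold e in E1, E2.
  assert (Hfz : Cmod L / 2 < Cmod (f z)).
  { pose proof (Cmod_triangle (f z) (- (f z - L))) as Ht.
    replace (f z + - (f z - L))%C with L in Ht by ring.
    rewrite Cmod_opp in Ht; lra. }
  assert (Hf0 : f z <> 0) by (apply Cmod_gt_0; lra).
  replace (/ f z - / L)%C with (- (f z - L) / (f z * L))%C by (now field).
  rewrite Cmod_div, Cmod_opp, Cmod_mult by (now apply Cmult_neq_0).
  apply Rmult_lt_reg_r with (Cmod (f z) * Cmod L); [nra|].
  unfold Rdiv; rewrite Rmult_assoc, Rinv_l by nra.
  rewrite Rmult_1_r. apply Rlt_le_trans with e; [easy|].
  apply Rle_trans with (1 := E2).
  apply Rmult_le_compat_l; [lra|]. nra.
Qed.

Lemma clim_pow (f : C -> C) (p L : C) (n : nat) :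
  clim f p L -> clim (fun z => f z ^ n)%C p (L ^ n)%C.
Proof.
  intros Hf; induction n as [|n IH].
  - exact (clim_const 1 p).
  - apply (clim_mult f (fun z => f z ^ n)%C p L (L ^ n)%C Hf IH).
Qed.

Lemma clim_div (f g : C -> C) (p L M : C) :
  M <> 0 -> clim f p L -> clim g p M -> clim (fun z => f z / g z)%C p (L / M)%C.
Proof. intros HM Hf Hg; apply clim_mult; [|apply clim_inv]; easy. Qed.

Lemma clim_minus (f g : C -> C) (p L M : C) :
  clim f p L -> clim g p M -> clim (fun z => f z - g z)%C p (L - M)%C.
Proof.
  intros Hf Hg; apply clim_plus; [easy|].
  replace (- M)%C with (- (1) * M)%C by ring.
  apply clim_ext_all with (fun z => - (1) * g z)%C; [intros; ring|].
  apply clim_mult; [apply clim_const|easy].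
Qed.

Lemma clim_neq_0 (f : C -> C) (p L : C) :
  L <> 0 -> clim f p L ->
  exists d, 0 < d /\ forall z, z <> p -> Cmod (z - p) < d -> f z <> 0.
Proof.
  intros HL Hf; destruct (Hf (Cmod L)) as [d [Hd H]]; [now apply Cmod_gt_0|].
  exists d; split; [easy|]; intros z Hz Hzp Hfz; specialize (H z Hz Hzp).
  rewrite Hfz in H. replace (0 - L)%C with (- L)%C in H by ring.
  rewrite Cmod_opp in H; lra.
Qed.

Lemma cderiv_clim (f : C -> C) (z l : C) : cderiv f z l -> clim f z (f z).
Proof.
  intros Hf.
  apply clim_ext_all with (fun w => f z + ((f w - f z) / (w - z)) * (w - z))%C.
  { intros w Hw; field; now apply Cminus_eq_contra. }
  replace (f z) with (f z + l * (z - z))%C at 1 by ring.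
  apply clim_plus; [apply clim_const|]; apply clim_mult; [easy|].
  apply clim_minus; [apply clim_id|apply clim_const].
Qed.

Lemma cderiv_const (k z : C) : cderiv (fun _ => k) z 0.
Proof.
  apply clim_ext_all with (fun _ => RtoC 0); [|apply clim_const].
  intros w Hw; field; now apply Cminus_eq_contra.
Qed.

Lemma cderiv_id (z : C) : cderiv (fun w => w) z 1.
Proof.
  apply clim_ext_all with (fun _ => RtoC 1); [|apply clim_const].
  intros w Hw; field; now apply Cminus_eq_contra.
Qed.

Lemma cderiv_plus (f g : C -> C) (z l m : C) :
  cderiv f z l -> cderiv g z m -> cderiv (fun w => f w + g w)%C z (l + m)%C.
Proof.
  intros Hf Hg.
  apply clim_ext_all with
    (fun w => (f w - f z) / (w - z) + (g w - g z) / (w - z))%C.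
  { intros w Hw; field; now apply Cminus_eq_contra. }
  now apply clim_plus.
Qed.

Lemma cderiv_mult (f g : C -> C) (z l m : C) :
  cderiv f z l -> cderiv g z m ->
  cderiv (fun w => f w * g w)%C z (l * g z + f z * m)%C.
Proof.
  intros Hf Hg.
  apply clim_ext_all with
    (fun w => (f w - f z) / (w - z) * g w + f z * ((g w - g z) / (w - z)))%C.
  { intros w Hw; field; now apply Cminus_eq_contra. }
  apply clim_plus; apply clim_mult; try easy.
  - now apply cderiv_clim with m.
  - apply clim_const.
Qed.

Lemma cderiv_minus (f g : C -> C) (z l m : C) :
  cderiv f z l -> cderiv g z m -> cderiv (fun w => f w - g w)%C z (l - m)%C.
Proof.
  intros Hf Hg.
  apply clim_ext_all with
    (fun w => (f w - f z) / (w - z) - (g w - g z) / (w - z))%C.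
  { intros w Hw; field; now apply Cminus_eq_contra. }
  now apply clim_minus.
Qed.

Lemma cderiv_inv (f : C -> C) (z l : C) :
  f z <> 0 -> cderiv f z l ->
  cderiv (fun w => / f w)%C z (- (l / (f z * f z)))%C.
Proof.
  intros Hfz Hf.
  pose proof (cderiv_clim f z l Hf) as Hc.
  destruct (clim_neq_0 f z (f z) Hfz Hc) as [d [Hd Hn]].
  replace (- (l / (f z * f z)))%C with (- (1) * (l / (f z * f z)))%C
    by (field; easy).
  apply clim_ext with
    (fun w => - (1) * (((f w - f z) / (w - z)) / (f w * f z)))%C d; [easy| |].
  { intros w Hw Hwz; field; repeat split; auto.
    now apply Cminus_eq_contra. }
  apply clim_mult; [apply clim_const|].
  apply clim_div; [now apply Cmult_neq_0|easy|].
  apply clim_mult; [easy|apply clim_const].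
Qed.

(** An injective inner map sends punctured neighbourhoods to punctured ones, so the difference
    quotients compose directly. It serves for halving the argument and for translations. *)
Lemma cderiv_affine (f : C -> C) (k m z l : C) :
  k <> 0 -> cderiv f (k * z + m)%C l ->
  cderiv (fun w => f (k * w + m)%C) z (k * l)%C.
Proof.
  intros Hk Hf.
  assert (Hk' : 0 < Cmod k) by now apply Cmod_gt_0.
  apply clim_ext_all with (fun w => k * ((f (k * w + m) - f (k * z + m))
    / ((k * w + m) - (k * z + m))))%C.
  { intros w Hw; field; repeat split; [now apply Cminus_eq_contra|].
    replace (k * w + m - (k * z + m))%C with (k * (w - z))%C by ring.
    apply Cmult_neq_0; [easy|now apply Cminus_eq_contra]. }
  apply clim_mult; [apply clim_const|].
  intros eps He; destruct (Hf eps He) as [d [Hd H]].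
  exists (d / Cmod k); split; [now apply Rdiv_lt_0_compat|].
  intros w Hw Hwz.
  apply (H (k * w + m)%C).
  - intros Heq; apply (Cmult_neq_0 k (w - z)); [easy|now apply Cminus_eq_contra|].
    replace (k * (w - z))%C with ((k * w + m) - (k * z + m))%C by ring.
    rewrite Heq; ring.
  - replace (k * w + m - (k * z + m))%C with (k * (w - z))%C by ring.
    rewrite Cmod_mult.
    replace d with (Cmod k * (d / Cmod k)) by (field; lra).
    now apply Rmult_lt_compat_l.
Qed.

Lemma is_derive_cderiv (f : C -> C) (z l : C) :
  @is_derive C_AbsRing C_NormedModule f z l -> cderiv f z l.
Proof.
  intros [_ H] eps He.
  specialize (H z (fun P HP => HP)).
  (* Half of eps, because the little-o bound is non-strict whereas [clim] asks for a strict one. *)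
  assert (He2 : 0 < eps / 2) by lra.
  destruct (H (mkposreal _ He2)) as [d Hd].
  exists d; split; [apply cond_pos|]; intros w Hw Hwz.
  specialize (Hd w Hwz); simpl in Hd.
  change (Cmod ((f w - f z) - (w - z) * l) <= eps / 2 * Cmod (w - z)) in Hd.
  assert (Hne : (w - z)%C <> 0) by now apply Cminus_eq_contra.
  assert (Hp : 0 < Cmod (w - z)) by now apply Cmod_gt_0.
  replace ((f w - f z) / (w - z) - l)%C
    with (((f w - f z) - (w - z) * l) / (w - z))%C by (now field).
  rewrite Cmod_div by easy.
  apply Rmult_lt_reg_r with (Cmod (w - z)); [easy|].
  unfold Rdiv; rewrite Rmult_assoc, Rinv_l by lra. nra.
Qed.

Lemma cderiv_linear_approx (f : C -> C) (z l : C) (eps : R) :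
  0 < eps -> cderiv f z l -> exists d, 0 < d /\ forall w, Cmod (w - z) < d ->
    Cmod (f w - (f z + l * (w - z))) <= eps * Cmod (w - z).
Proof.
  intros He Hf; destruct (Hf eps He) as [d [Hd H]].
  exists d; split; [easy|]; intros w Hw.
  destruct (Ceq_dec w z) as [->|Hwz].
  { replace (f z - (f z + l * (z - z)))%C with (RtoC 0) by ring.
    replace (z - z)%C with (RtoC 0) by ring. rewrite Cmod_0; lra. }
  specialize (H w Hwz Hw).
  assert (Hne : (w - z)%C <> 0) by now apply Cminus_eq_contra.
  replace (f w - (f z + l * (w - z)))%C
    with (((f w - f z) / (w - z) - l) * (w - z))%C by (now field).
  rewrite Cmod_mult; apply Rmult_le_compat_r; [apply Cmod_ge_0|lra].
Qed.

(** * Integrals along the boundary of a rectangle *)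

Definition is_CInt (g : R -> C) (a b : R) (l : C) : Prop :=
  @is_RInt C_R_NormedModule g a b l.

Definition CInt (g : R -> C) (a b : R) : C :=
  @RInt C_R_CompleteNormedModule g a b.

Definition Ccontinuous (g : R -> C) (t : R) : Prop :=
  @continuous R_UniformSpace C_UniformSpace g t.

Lemma CInt_correct (g : R -> C) (a b : R) :
  a <= b -> (forall t, a <= t <= b -> Ccontinuous g t) ->
  is_CInt g a b (CInt g a b).
Proof.
  intros Hab Hg; apply (@RInt_correct C_R_CompleteNormedModule).
  apply (@ex_RInt_continuous C_R_CompleteNormedModule).
  rewrite Rmin_left, Rmax_right by easy; exact Hg.
Qed.

Lemma is_CInt_unique (g : R -> C) (a b : R) (l : C) :
  is_CInt g a b l -> CInt g a b = l.
Proof. apply (@is_RInt_unique C_R_CompleteNormedModule). Qed.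

Lemma is_CInt_pair (g : R -> C) (a b : R) (l : C) :
  is_CInt g a b l <->
  is_RInt (fun t => Re (g t)) a b (Re l) /\ is_RInt (fun t => Im (g t)) a b (Im l).
Proof.
  split.
  - intros H; split.
    + exact (@is_RInt_fct_extend_fst R_NormedModule R_NormedModule g a b l H).
    + exact (@is_RInt_fct_extend_snd R_NormedModule R_NormedModule g a b l H).
  - intros [H1 H2]; destruct l as [u v].
    exact (@is_RInt_fct_extend_pair R_NormedModule R_NormedModule g a b u v H1 H2).
Qed.

Lemma is_CInt_plus (f g : R -> C) (a b : R) (l m : C) :
  is_CInt f a b l -> is_CInt g a b m ->
  is_CInt (fun t => f t + g t)%C a b (l + m)%C.
Proof. apply (@is_RInt_plus C_R_NormedModule). Qed.

(** The scalars of [C_R_NormedModule] are real, so a complex factor is treated through real and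
    imaginary parts. *)
Lemma is_CInt_mult_l (k : C) (f : R -> C) (a b : R) (l : C) :
  is_CInt f a b l -> is_CInt (fun t => k * f t)%C a b (k * l)%C.
Proof.
  intros H; apply is_CInt_pair in H as [H1 H2]; apply is_CInt_pair; split.
  - apply is_RInt_ext with (fun t => minus (scal (Re k) (Re (f t))) (scal (Im k) (Im (f t)))).
    { intros; rewrite re_mult; reflexivity. }
    rewrite re_mult.
    apply (is_RInt_minus (V := R_NormedModule)); now apply (is_RInt_scal (V := R_NormedModule)).
  - apply is_RInt_ext with (fun t => plus (scal (Re k) (Im (f t))) (scal (Im k) (Re (f t)))).
    { intros; rewrite im_mult; reflexivity. }
    rewrite im_mult.
    apply (is_RInt_plus (V := R_NormedModule)); now apply (is_RInt_scal (V := R_NormedModule)).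
Qed.

Lemma is_CInt_Chasles (g : R -> C) (a b c : R) (l m : C) :
  is_CInt g a b l -> is_CInt g b c m -> is_CInt g a c (l + m)%C.
Proof. apply (@is_RInt_Chasles C_R_NormedModule). Qed.

Lemma CInt_Chasles (g : R -> C) (a b c : R) :
  a <= b <= c -> (forall t, a <= t <= c -> Ccontinuous g t) ->
  CInt g a c = (CInt g a b + CInt g b c)%C.
Proof.
  intros Hb Hg; apply is_CInt_unique, is_CInt_Chasles with b;
    apply CInt_correct; try lra; intros; apply Hg; lra.
Qed.

Lemma is_CInt_bound (g : R -> C) (a b M : R) (l : C) :
  a <= b -> (forall t, a <= t <= b -> Cmod (g t) <= M) ->
  is_CInt g a b l -> Cmod l <= (b - a) * M.
Proof.
  assert (N : forall z : C, @norm _ C_R_NormedModule z = Cmod z).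
  { intros [x y]; unfold Cmod; simpl.
    change (sqrt (Rabs x ^ 2 + Rabs y ^ 2) = sqrt (x ^ 2 + y ^ 2)).
    now rewrite !pow2_abs. }
  intros Hab Hg Hl; rewrite <- N.
  apply (norm_RInt_le_const g a b l M Hab); [|easy].
  intros t Ht; rewrite N; auto.
Qed.

Lemma is_CInt_affine (k m : C) (a b : R) :
  is_CInt (fun t => k + m * t)%C a b
    (k * (b - a) + m * ((b * b - a * a) / 2))%C.
Proof.
  apply is_CInt_plus.
  - apply (fun H => @is_RInt_ext C_R_NormedModule (fun _ => (k * 1)%C) _ a b _ H).
    { intros; simpl; ring. }
    apply (is_CInt_mult_l k (fun _ => RtoC 1)).
    apply is_CInt_pair; split.
    + replace (Re (b - a)) with (scal (b - a) 1)
        by (unfold scal; simpl; unfold mult; simpl; ring).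
      apply (is_RInt_const (V := R_NormedModule)).
    + replace (Im (b - a)) with (scal (b - a) 0)
        by (unfold scal; simpl; unfold mult; simpl; ring).
      apply (is_RInt_const (V := R_NormedModule)).
  - apply is_CInt_mult_l.
    replace ((b * b - a * a) / 2)%C with (RtoC ((b * b - a * a) / 2)).
    2: { rewrite <- !RtoC_mult, <- RtoC_minus, <- RtoC_div; [reflexivity|lra]. }
    apply is_CInt_pair; split.
    + replace (Re (RtoC ((b * b - a * a) / 2))) with (minus (b * b / 2) (a * a / 2))
        by (unfold minus, plus, opp; simpl; field).
      apply (is_RInt_derive (fun x => x * x / 2) (fun x => x)).
      * intros x _; auto_derive; [easy|field].
      * intros x _; apply continuous_id.
    + replace (Im (RtoC ((b * b - a * a) / 2))) with (scal (b - a) 0)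
        by (unfold scal; simpl; unfold mult; simpl; ring).
      apply (is_RInt_const (V := R_NormedModule)).
Qed.

(** The isometry hypothesis reflects that the sides of a rectangle are parametrised by arc
    length. *)
Lemma clim_continuous (f : C -> C) (g : R -> C) (t : R) :
  (forall s, Cmod (g s - g t) = Rabs (s - t)) ->
  clim f (g t) (f (g t)) -> Ccontinuous (fun s => f (g s)) t.
Proof.
  intros Hg Hf; apply (filterlim_locally (fun s => f (g s))); intros eps.
  destruct (Hf eps (cond_pos eps)) as [d [Hd H]].
  exists (mkposreal d Hd); intros s Hs.
  apply C_NormedModule_mixin_compat1.
  destruct (Ceq_dec (g s) (g t)) as [->|Hne].
  - replace (minus (f (g t)) (f (g t))) with (RtoC 0).
    + rewrite Cmod_0; apply cond_pos.
    + symmetry; apply (plus_opp_r (G := C_AbelianGroup)).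
  - apply H; [easy|]; rewrite Hg; exact Hs.
Qed.

(* The boundary is traversed counterclockwise. *)
Definition rectint (f : C -> C) (a b c d : R) : C :=
  (CInt (fun x => f (x, c)) a b - CInt (fun x => f (x, d)) a b
   + Ci * (CInt (fun y => f (b, y)) c d - CInt (fun y => f (a, y)) c d))%C.

Lemma clim_continuous_x (f : C -> C) (x y : R) :
  clim f (x, y) (f (x, y)) -> Ccontinuous (fun t => f (t, y)) x.
Proof.
  apply clim_continuous with (g := fun t => (t, y)); intros s.
  replace ((s, y) - (x, y))%C with (RtoC (s - x)); [apply Cmod_R|].
  unfold RtoC, Cminus, Cplus, Copp; simpl; f_equal; ring.
Qed.

Lemma clim_continuous_y (f : C -> C) (x y : R) :
  clim f (x, y) (f (x, y)) -> Ccontinuous (fun t => f (x, t)) y.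
Proof.
  apply clim_continuous with (g := fun t => (x, t)); intros s.
  replace ((x, s) - (x, y))%C with (Ci * RtoC (s - y))%C.
  - rewrite Cmod_mult, Cmod_R, Cmod_Ci; ring.
  - unfold Ci, RtoC, Cmult, Cminus, Cplus, Copp; simpl; f_equal; ring.
Qed.

Definition on_rect (a b c d : R) (z : C) : Prop :=
  (a <= Re z <= b /\ (Im z = c \/ Im z = d)) \/
  (c <= Im z <= d /\ (Re z = a \/ Re z = b)).

Definition in_rect (a b c d : R) (z : C) : Prop :=
  a <= Re z <= b /\ c <= Im z <= d.

Lemma on_rect_in (a b c d : R) (z : C) :
  a <= b -> c <= d -> on_rect a b c d z -> in_rect a b c d z.
Proof. unfold on_rect, in_rect; lra. Qed.

Definition cont_on_rect (f : C -> C) (a b c d : R) : Prop :=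
  forall z, on_rect a b c d z -> clim f z (f z).

Lemma rectint_sides (f : C -> C) (a b c d : R) :
  a <= b -> c <= d -> cont_on_rect f a b c d ->
  is_CInt (fun x => f (x, c)) a b (CInt (fun x => f (x, c)) a b) /\
  is_CInt (fun x => f (x, d)) a b (CInt (fun x => f (x, d)) a b) /\
  is_CInt (fun y => f (a, y)) c d (CInt (fun y => f (a, y)) c d) /\
  is_CInt (fun y => f (b, y)) c d (CInt (fun y => f (b, y)) c d).
Proof.
  intros Hab Hcd Hf; repeat split; apply CInt_correct; try easy; intros t Ht.
  1,2: apply clim_continuous_x, Hf; left; simpl; tauto.
  1,2: apply clim_continuous_y, Hf; right; simpl; tauto.
Qed.

Lemma rectint_linear (f g : C -> C) (k : C) (a b c d : R) :
  a <= b -> c <= d -> cont_on_rect f a b c d -> cont_on_rect g a b c d ->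
  rectint (fun z => f z + k * g z)%C a b c d
  = (rectint f a b c d + k * rectint g a b c d)%C.
Proof.
  intros Hab Hcd Hf Hg.
  destruct (rectint_sides f a b c d Hab Hcd Hf) as [F1 [F2 [F3 F4]]].
  destruct (rectint_sides g a b c d Hab Hcd Hg) as [G1 [G2 [G3 G4]]].
  unfold rectint.
  rewrite (is_CInt_unique _ _ _ _ (is_CInt_plus _ _ _ _ _ _ F1 (is_CInt_mult_l k _ _ _ _ G1))).
  rewrite (is_CInt_unique _ _ _ _ (is_CInt_plus _ _ _ _ _ _ F2 (is_CInt_mult_l k _ _ _ _ G2))).
  rewrite (is_CInt_unique _ _ _ _ (is_CInt_plus _ _ _ _ _ _ F3 (is_CInt_mult_l k _ _ _ _ G3))).
  rewrite (is_CInt_unique _ _ _ _ (is_CInt_plus _ _ _ _ _ _ F4 (is_CInt_mult_l k _ _ _ _ G4))).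
  ring.
Qed.

Lemma rectint_bound (f : C -> C) (a b c d M : R) :
  a <= b -> c <= d -> cont_on_rect f a b c d ->
  (forall z, on_rect a b c d z -> Cmod (f z) <= M) ->
  Cmod (rectint f a b c d) <= 2 * ((b - a) + (d - c)) * M.
Proof.
  intros Hab Hcd Hf HM.
  destruct (rectint_sides f a b c d Hab Hcd Hf) as [F1 [F2 [F3 F4]]].
  apply is_CInt_bound with (M := M) in F1, F2, F3, F4; try easy.
  2-3: intros t Ht; apply HM; right; simpl; tauto.
  2-3: intros t Ht; apply HM; left; simpl; tauto.
  unfold rectint.
  apply Rle_trans with (1 := Cmod_triangle _ _).
  rewrite Cmod_mult, Cmod_Ci.
  pose proof (Cmod_triangle (CInt (fun x => f (x, c)) a b) (- CInt (fun x => f (x, d)) a b)) as T1.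
  pose proof (Cmod_triangle (CInt (fun y => f (b, y)) c d) (- CInt (fun y => f (a, y)) c d)) as T2.
  rewrite Cmod_opp in T1, T2. unfold Cminus. lra.
Qed.

(** The two integrals along the cut carry opposite signs and cancel as terms; continuity concerns
    the horizontal sides, which are the ones divided. *)
Lemma rectint_split_x (f : C -> C) (a m b c d : R) :
  a <= m <= b ->
  (forall x, a <= x <= b -> clim f (x, c) (f (x, c)) /\ clim f (x, d) (f (x, d))) ->
  rectint f a b c d = (rectint f a m c d + rectint f m b c d)%C.
Proof.
  intros Hm Hf; unfold rectint.
  rewrite (CInt_Chasles (fun x => f (x, c)) a m b), (CInt_Chasles (fun x => f (x, d)) a m b);
    try easy; try ring.
  all: intros; apply clim_continuous_x; now apply Hf.
Qed.

Lemma rectint_split_y (f : C -> C) (a b c m d : R) :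
  c <= m <= d ->
  (forall y, c <= y <= d -> clim f (a, y) (f (a, y)) /\ clim f (b, y) (f (b, y))) ->
  rectint f a b c d = (rectint f a b c m + rectint f a b m d)%C.
Proof.
  intros Hm Hf; unfold rectint.
  rewrite (CInt_Chasles (fun y => f (a, y)) c m d), (CInt_Chasles (fun y => f (b, y)) c m d);
    try easy; try ring.
  all: intros; apply clim_continuous_y; now apply Hf.
Qed.

Lemma CInt_ext (f g : R -> C) (a b : R) :
  (forall t, f t = g t) -> CInt f a b = CInt g a b.
Proof. intros H; apply (@RInt_ext C_R_CompleteNormedModule); auto. Qed.

Lemma rectint_ext (f g : C -> C) (a b c d : R) :
  (forall z, f z = g z) -> rectint f a b c d = rectint g a b c d.
Proof.
  intros H; unfold rectint.
  rewrite (CInt_ext (fun x => f (x, c)) (fun x => g (x, c))),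
    (CInt_ext (fun x => f (x, d)) (fun x => g (x, d))),
    (CInt_ext (fun y => f (b, y)) (fun y => g (b, y))),
    (CInt_ext (fun y => f (a, y)) (fun y => g (a, y))) by (intros; apply H).
  reflexivity.
Qed.

(** The horizontal sides differ by m i (c - d) over a length b - a, the vertical ones by m (b - a)
    over a length d - c with a factor i; the two contributions are opposite. *)
Lemma rectint_affine (k m : C) (a b c d : R) :
  rectint (fun z => k + m * z)%C a b c d = 0.
Proof.
  assert (X : forall y u v : R, CInt (fun x => k + m * (x, y))%C u v
    = ((k + m * Ci * y) * (v - u) + m * ((v * v - u * u) / 2))%C).
  { intros y u v; rewrite <- (is_CInt_unique _ _ _ _ (is_CInt_affine _ _ _ _)).
    apply CInt_ext; intros x.
    replace ((x, y) : C) with (x + Ci * y)%C; [ring|].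
    unfold Ci, RtoC, Cplus, Cmult; simpl; f_equal; ring. }
  assert (Y : forall x u v : R, CInt (fun y => k + m * (x, y))%C u v
    = ((k + m * x) * (v - u) + m * Ci * ((v * v - u * u) / 2))%C).
  { intros x u v; rewrite <- (is_CInt_unique _ _ _ _ (is_CInt_affine _ _ _ _)).
    apply CInt_ext; intros y.
    replace ((x, y) : C) with (x + Ci * y)%C; [ring|].
    unfold Ci, RtoC, Cplus, Cmult; simpl; f_equal; ring. }
  unfold rectint; rewrite !X, !Y.
  field; apply Cmod_gt_0; rewrite Cmod_R, Rabs_pos_eq; lra.
Qed.

(** * Goursat's theorem *)

(** The left ends increase and the right ends decrease, so every right end bounds all left ends, and
    the supremum of the left ends lies in every interval. *)
Lemma nested_intervals (u : nat -> R) (w : R) :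
  0 <= w ->
  (forall n, u n <= u (S n) <= u n + (/ 2) ^ S n * w) ->
  exists x, forall n, u n <= x <= u n + (/ 2) ^ n * w.
Proof.
  intros Hw Hu.
  assert (Hs : forall n, 0 < (/ 2) ^ n) by (intros; apply pow_lt; lra).
  assert (Hinc : forall n k, u n <= u (n + k)%nat).
  { intros n k; induction k as [|k IH]; [rewrite Nat.add_0_r; lra|].
    rewrite Nat.add_succ_r; destruct (Hu (n + k)%nat); lra. }
  assert (Hdec : forall n k,
    u (n + k)%nat + (/ 2) ^ (n + k) * w <= u n + (/ 2) ^ n * w).
  { intros n k; induction k as [|k IH]; [rewrite Nat.add_0_r; lra|].
    rewrite Nat.add_succ_r; destruct (Hu (n + k)%nat) as [_ H].
    simpl in *; lra. }
  assert (Hub : forall m n, u m <= u n + (/ 2) ^ n * w).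
  { intros m n; destruct (Nat.le_ge_cases m n) as [H|H].
    - replace n with (m + (n - m))%nat by lia.
      specialize (Hinc m (n - m)%nat); specialize (Hs (m + (n - m))%nat); nra.
    - replace m with (n + (m - n))%nat by lia.
      specialize (Hdec n (m - n)%nat); specialize (Hs (n + (m - n))%nat); nra. }
  destruct (completeness (fun r => exists n, r = u n)) as [x [Hx1 Hx2]].
  - exists (u 0%nat + (/ 2) ^ 0 * w); intros r [n ->]; apply Hub.
  - exists (u 0%nat), 0%nat; easy.
  - exists x; intros n; split; [apply Hx1; now exists n|].
    apply Hx2; intros r [m ->]; apply Hub.
Qed.

(* If [P] failed on the whole rectangle, it would fail on a nested sequence of
   quarters, which shrinks to a point. *)
Lemma quadrisection (P : R -> R -> R -> Prop) (a c w h : R) :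
  0 <= w -> 0 <= h ->
  (forall u v s, 0 < s -> P u v (s / 2) -> P (u + s / 2 * w) v (s / 2) ->
    P u (v + s / 2 * h) (s / 2) -> P (u + s / 2 * w) (v + s / 2 * h) (s / 2) ->
    P u v s) ->
  (forall x y, a <= x <= a + w -> c <= y <= c + h ->
    exists d, 0 < d /\ forall u v s, 0 < s < d ->
      u <= x <= u + s * w -> v <= y <= v + s * h -> P u v s) ->
  P a c 1.
Proof.
  intros Hw Hh Hsub Hloc; apply NNPP; intros Hbad.
  (* The failure is carried in the type, so that the recursion [p] can always choose a bad quarter
     of its current rectangle; indefinite description turns the existence of that quarter into the
     function [step]. *)
  set (Bad := fun n => {p : R * R | ~ P (fst p) (snd p) ((/ 2) ^ n)}).
  assert (step : forall n (p : Bad n), {q : Bad (S n) |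
    let u := fst (proj1_sig p) in let u' := fst (proj1_sig q) in
    let v := snd (proj1_sig p) in let v' := snd (proj1_sig q) in
    (u <= u' <= u + (/ 2) ^ S n * w) /\ (v <= v' <= v + (/ 2) ^ S n * h)}).
  { intros n [[u v] Hp]; apply constructive_indefinite_description; simpl in *.
    assert (Hs : 0 < (/ 2) ^ n) by (apply pow_lt; lra).
    assert (E : (/ 2) ^ n / 2 = (/ 2) ^ S n) by (simpl; field).
    pose proof (Hsub u v _ Hs) as H; rewrite E in H.
    simpl in *; set (s := / 2 * (/ 2) ^ n) in *.
    assert (Hsw : 0 <= s * w) by (unfold s; nra).
    assert (Hsh : 0 <= s * h) by (unfold s; nra).
    assert (K : forall u' v', ~ P u' v' s -> u <= u' <= u + s * w ->
      v <= v' <= v + s * h -> exists q : Bad (S n),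
      (u <= fst (proj1_sig q) <= u + s * w) /\
      (v <= snd (proj1_sig q) <= v + s * h)).
    { intros u' v' H1 H2 H3.
      now exists (exist (fun p : R * R => ~ P (fst p) (snd p) ((/ 2) ^ S n))
        (u', v') H1). }
    destruct (classic (P u v s)) as [P1|P1]; [|apply (K _ _ P1); lra].
    destruct (classic (P (u + s * w) v s)) as [P2|P2]; [|apply (K _ _ P2); lra].
    destruct (classic (P u (v + s * h) s)) as [P3|P3]; [|apply (K _ _ P3); lra].
    destruct (classic (P (u + s * w) (v + s * h) s)) as [P4|P4];
      [|apply (K _ _ P4); lra].
    now elim Hp; apply H. }
  set (p := fix p n : Bad n := match n with
    | O => exist (fun p : R * R => ~ P (fst p) (snd p) ((/ 2) ^ 0)) (a, c) Hbad
    | S n => proj1_sig (step n (p n)) end).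
  assert (Hp : forall n, let u := fst (proj1_sig (p n)) in
    let u' := fst (proj1_sig (p (S n))) in
    let v := snd (proj1_sig (p n)) in let v' := snd (proj1_sig (p (S n))) in
    (u <= u' <= u + (/ 2) ^ S n * w) /\ (v <= v' <= v + (/ 2) ^ S n * h)).
  { intros n; exact (proj2_sig (step n (p n))). }
  destruct (nested_intervals (fun n => fst (proj1_sig (p n))) w Hw
    (fun n => proj1 (Hp n))) as [x Hx].
  destruct (nested_intervals (fun n => snd (proj1_sig (p n))) h Hh
    (fun n => proj2 (Hp n))) as [y Hy].
  pose proof (Hx 0%nat) as Hx0; pose proof (Hy 0%nat) as Hy0; simpl in Hx0, Hy0.
  destruct (Hloc x y) as [d [Hd H]]; [lra|lra|].
  assert (H2 : Rabs (/ 2) < 1) by (rewrite Rabs_pos_eq; lra).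
  destruct (pow_lt_1_zero (/ 2) H2 d Hd) as [N HN].
  specialize (HN N (Nat.le_refl N)).
  assert (Hs : 0 < (/ 2) ^ N) by (apply pow_lt; lra).
  rewrite Rabs_pos_eq in HN by lra.
  apply (proj2_sig (p N)), H; [lra|apply Hx|apply Hy].
Qed.

Lemma Cmod_le_abs (z : C) : Cmod z <= Rabs (Re z) + Rabs (Im z).
Proof.
  replace z with (RtoC (Re z) + Ci * RtoC (Im z))%C at 1.
  - apply Rle_trans with (1 := Cmod_triangle _ _).
    rewrite Cmod_mult, Cmod_Ci, !Cmod_R; lra.
  - destruct z as [x y]; unfold Ci, RtoC, Cplus, Cmult; simpl; f_equal; ring.
Qed.

Definition holomorphic_in (D : C -> Prop) (f : C -> C) : Prop :=
  forall z, D z -> exists l, cderiv f z l.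

(** The affine approximation at p integrates to 0. With s = (b - a) + (d' - c), the remainder is at
    most eps / 2 times s on a contour of length 2 s, which gives eps s^2. *)
Lemma rectint_local (f : C -> C) (p l : C) (eps : R) :
  0 < eps -> cderiv f p l -> exists d, 0 < d /\ forall a b c d',
    a <= b -> c <= d' -> (b - a) + (d' - c) < d -> in_rect a b c d' p ->
    cont_on_rect f a b c d' ->
    Cmod (rectint f a b c d') <= eps * ((b - a) + (d' - c)) ^ 2.
Proof.
  intros He Hf.
  destruct (cderiv_linear_approx f p l (eps / 2)) as [r [Hr H]]; [lra|easy|].
  exists r; split; [easy|]; intros a b c d Hab Hcd Hsmall Hp Hc.
  set (g := fun z => ((f p - l * p) + l * z)%C).
  assert (Hg : forall z, clim g z (g z)).
  { intros z; apply clim_plus; [apply clim_const|].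
    apply clim_mult; [apply clim_const|apply clim_id]. }
  rewrite (rectint_ext f (fun z => (f z + - (1) * g z) + 1 * g z)%C)
    by (intros; ring).
  rewrite rectint_linear; [|easy|easy| |now intros z _].
  2: { intros z Hz; apply clim_plus; [now apply Hc|].
       apply clim_mult; [apply clim_const|auto]. }
  unfold g at 2; rewrite rectint_affine, Cmult_0_r, Cplus_0_r.
  replace (eps * (b - a + (d - c)) ^ 2)
    with (2 * (b - a + (d - c)) * (eps / 2 * (b - a + (d - c)))) by field.
  apply rectint_bound; try easy.
  - intros z Hz; apply clim_plus; [now apply Hc|].
    apply clim_mult; [apply clim_const|auto].
  - intros z Hz; apply on_rect_in in Hz; try easy.
    assert (Hzp : Cmod (z - p) <= (b - a) + (d - c)).
    { apply Rle_trans with (1 := Cmod_le_abs _).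
      destruct Hz as [Hz1 Hz2], Hp as [Hp1 Hp2].
      apply Rplus_le_compat.
      - unfold Cminus; rewrite re_plus, re_opp; apply Rabs_le; lra.
      - unfold Cminus; rewrite im_plus, im_opp; apply Rabs_le; lra. }
    replace (f z + - (1) * g z)%C with (f z - (f p + l * (z - p)))%C
      by (unfold g; ring).
    apply Rle_trans with (1 := H z ltac:(lra)).
    apply Rmult_le_compat_l; lra.
Qed.

Lemma holomorphic_clim (D : C -> Prop) (f : C -> C) (z : C) :
  holomorphic_in D f -> D z -> clim f z (f z).
Proof. intros Hf Hz; destruct (Hf z Hz) as [l Hl]; now apply cderiv_clim with l. Qed.

Lemma Goursat (f : C -> C) (a b c d : R) :
  a <= b -> c <= d -> holomorphic_in (in_rect a b c d) f ->
  rectint f a b c d = 0.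
Proof.
  intros Hab Hcd Hf.
  assert (Hc : forall x y, a <= x <= b -> c <= y <= d -> clim f (x, y) (f (x, y))).
  { intros x y Hx Hy; apply (holomorphic_clim (in_rect a b c d)); easy. }
  assert (Hc' : forall a' b' c' d', a <= a' <= b' -> b' <= b -> c <= c' <= d' -> d' <= d ->
    cont_on_rect f a' b' c' d').
  { intros a' b' c' d' H1 H2 H3 H4 [x y] Hz; apply on_rect_in in Hz; try lra.
    destruct Hz; simpl in *; apply Hc; lra. }
  set (w := b - a); set (h := d - c).
  assert (Hw : 0 <= w) by (unfold w; lra).
  assert (Hh : 0 <= h) by (unfold h; lra).
  assert (key : forall eps, 0 < eps -> Cmod (rectint f a b c d) <= eps * (w + h) ^ 2).
  { intros eps He.
    (* The bound scales like an area: four quarters of scale s / 2 contribute 4 (s / 2)^2 = s^2, so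
       it passes from the quarters to the whole without loss. The premises confine the rectangle to
       the original one. *)
    set (P := fun u v s => a <= u -> u + s * w <= b -> c <= v -> v + s * h <= d ->
      Cmod (rectint f u (u + s * w) v (v + s * h)) <= s ^ 2 * (eps * (w + h) ^ 2)).
    assert (HP : P a c 1).
    { apply (quadrisection P a c w h Hw Hh); unfold P.
      - intros u v s Hs H1 H2 H3 H4 Hu Hu' Hv Hv'.
        assert (Hsw : 0 <= s * w) by nra. assert (Hsh : 0 <= s * h) by nra.
        specialize (H1 ltac:(lra) ltac:(lra) ltac:(lra) ltac:(lra)).
        specialize (H2 ltac:(lra) ltac:(lra) ltac:(lra) ltac:(lra)).
        specialize (H3 ltac:(lra) ltac:(lra) ltac:(lra) ltac:(lra)).
        specialize (H4 ltac:(lra) ltac:(lra) ltac:(lra) ltac:(lra)).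
        replace (u + s / 2 * w + s / 2 * w) with (u + s * w) in * by field.
        replace (v + s / 2 * h + s / 2 * h) with (v + s * h) in * by field.
        rewrite (rectint_split_x f u (u + s / 2 * w) (u + s * w)); [|lra|].
        2: { intros x Hx; split; apply Hc; lra. }
        rewrite !(rectint_split_y f _ _ v (v + s / 2 * h) (v + s * h)); try lra.
        2,3: intros y Hy; split; apply Hc; lra.
        apply Rle_trans with (1 := Cmod_triangle _ _).
        eapply Rle_trans;
          [apply Rplus_le_compat; apply Cmod_triangle|].
        lra.
      - intros x y Hx Hy.
        destruct (Hf (x, y)) as [l Hl]; [unfold in_rect, w, h in *; simpl; lra|].
        destruct (rectint_local f (x, y) l eps He Hl) as [r [Hr H]].
        (* The added 1 keeps the denominator positive for a degenerate rectangle. *)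
        exists (r / (w + h + 1)); split; [apply Rdiv_lt_0_compat; lra|].
        intros u v s [Hs Hsr] Hux Hvy Hu Hu' Hv Hv'.
        assert (Hsw : 0 <= s * w) by nra. assert (Hsh : 0 <= s * h) by nra.
        replace (s ^ 2 * (eps * (w + h) ^ 2))
          with (eps * ((u + s * w - u) + (v + s * h - v)) ^ 2) by ring.
        apply H; try lra.
        + apply Rmult_lt_compat_r with (r := w + h + 1) in Hsr; [|lra].
          unfold Rdiv in Hsr; rewrite Rmult_assoc, Rinv_l in Hsr; lra.
        + unfold in_rect; simpl; lra.
        + apply Hc'; lra. }
    unfold P, w, h in HP |- *.
    replace (a + 1 * (b - a)) with b in HP by ring.
    replace (c + 1 * (d - c)) with d in HP by ring.
    specialize (HP ltac:(lra) ltac:(lra) ltac:(lra) ltac:(lra)); lra. }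
  apply Cmod_eq_0; apply Rle_antisym; [|apply Cmod_ge_0].
  apply le_epsilon; intros eps He.
  pose proof (pow2_ge_0 (w + h)) as Hq.
  apply Rle_trans with (1 := key (eps / ((w + h) ^ 2 + 1)) ltac:(apply Rdiv_lt_0_compat; lra)).
  apply Rmult_le_reg_r with ((w + h) ^ 2 + 1); [lra|].
  unfold Rdiv; rewrite Rmult_assoc, (Rmult_comm ((w + h) ^ 2)), <- Rmult_assoc.
  rewrite (Rmult_assoc eps), Rinv_l by lra. nra.
Qed.

(** * Isolated singularities *)

Lemma im_le_Cmod (z : C) : Rabs (Im z) <= Cmod z.
Proof. apply Rle_trans with (2 := Rmax_Cmod z), Rmax_r. Qed.

Lemma on_square_dist (p z : C) (r : R) : 0 < r ->
  on_rect (Re p - r) (Re p + r) (Im p - r) (Im p + r) z ->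
  r <= Cmod (z - p) <= 2 * r.
Proof.
  intros Hr Hz.
  assert (E1 : Re (z - p) = Re z - Re p) by (unfold Cminus; rewrite re_plus, re_opp; ring).
  assert (E2 : Im (z - p) = Im z - Im p) by (unfold Cminus; rewrite im_plus, im_opp; ring).
  pose proof (re_le_Cmod (z - p)) as H1; pose proof (im_le_Cmod (z - p)) as H2.
  pose proof (Cmod_le_abs (z - p)) as H3.
  rewrite E1 in *; rewrite E2 in *.
  destruct Hz as [[Hx [Hy|Hy]]|[Hy [Hx|Hx]]]; revert H1 H2 H3;
    unfold Rabs; destruct (Rcase_abs _), (Rcase_abs _); lra.
Qed.

(** Two vertical and two horizontal cuts leave a square of half-side r around p, since Goursat's
    theorem disposes of the other four pieces. The contour of the square has length 8 r and stays at
    distance at least r from p, so |q| <= eps / (8 r) on it and the integral is at most eps. *)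
Lemma rectint_exceptional (q : C -> C) (a b c d : R) (p : C) :
  a < Re p < b -> c < Im p < d ->
  holomorphic_in (fun z => in_rect a b c d z /\ z <> p) q ->
  clim (fun z => (z - p) * q z)%C p 0 ->
  rectint q a b c d = 0.
Proof.
  intros Hx Hy Hq Hlim.
  assert (Hc : forall x y, a <= x <= b -> c <= y <= d -> x <> Re p \/ y <> Im p ->
    clim q (x, y) (q (x, y))).
  { intros x y H1 H2 H3; apply holomorphic_clim with (1 := Hq).
    split; [easy|]; intros <-; simpl in H3; lra. }
  assert (HG : forall a' b' c' d', a <= a' <= b' -> b' <= b -> c <= c' <= d' ->
    d' <= d -> b' < Re p \/ Re p < a' \/ d' < Im p \/ Im p < c' ->
    rectint q a' b' c' d' = 0).
  { intros a' b' c' d' H1 H2 H3 H4 H5; apply Goursat; try lra.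
    intros z [Hz1 Hz2]; apply Hq; split; [split; lra|].
    intros ->; lra. }
  apply Cmod_eq_0; apply Rle_antisym; [|apply Cmod_ge_0].
  apply le_epsilon; intros eps He.
  destruct (Hlim (eps / 8)) as [r0 [Hr0 H]]; [lra|].
  assert (Hr : exists r, 0 < r /\ 2 * r < r0 /\ r < Re p - a /\ r < b - Re p /\
     r < Im p - c /\ r < d - Im p).
  { exists (Rmin (r0 / 4) (Rmin (Rmin (Re p - a) (b - Re p) / 2)
      (Rmin (Im p - c) (d - Im p) / 2))).
    unfold Rmin; repeat destruct (Rle_dec _ _); lra. }
  destruct Hr as [r [Hr [Hr1 [Hr2 [Hr3 [Hr4 Hr5]]]]]].
  rewrite (rectint_split_x q a (Re p - r) b), (rectint_split_x q (Re p - r) (Re p + r) b);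
    try lra.
  2,3: intros x Hx'; split; apply Hc; lra.
  rewrite (rectint_split_y q (Re p - r) (Re p + r) c (Im p - r) d),
    (rectint_split_y q (Re p - r) (Re p + r) (Im p - r) (Im p + r) d); try lra.
  2,3: intros y Hy'; split; apply Hc; lra.
  rewrite (HG a), (HG (Re p + r)), (HG _ _ c), (HG _ _ (Im p + r)) by lra.
  replace (0 + (0 + (rectint q (Re p - r) (Re p + r) (Im p - r) (Im p + r) + 0) + 0))%C
    with (rectint q (Re p - r) (Re p + r) (Im p - r) (Im p + r)) by ring.
  apply Rle_trans with (2 * (2 * r + 2 * r) * (eps / 8 / r)).
  2: { right; field; lra. }
  replace (2 * (2 * r + 2 * r)) with
    (2 * ((Re p + r - (Re p - r)) + (Im p + r - (Im p - r)))) by ring.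
  apply rectint_bound; try lra.
  - intros [x y] Hz; apply on_square_dist in Hz as Hz'; [|easy].
    apply on_rect_in in Hz as Hz''; try lra; destruct Hz'' as [Hz1 Hz2].
    simpl in Hz1, Hz2; unfold on_rect in Hz; simpl in Hz; apply Hc; lra.
  - intros z Hz; apply on_square_dist in Hz as [Hz1 Hz2]; [|easy].
    assert (Hzp : z <> p).
    { intros ->; replace (p - p)%C with (RtoC 0) in Hz1 by ring.
      rewrite Cmod_0 in Hz1; lra. }
    specialize (H z Hzp ltac:(lra)).
    replace ((z - p) * q z - 0)%C with ((z - p) * q z)%C in H by ring.
    rewrite Cmod_mult in H.
    apply Rmult_le_reg_l with r; [easy|].
    replace (r * (eps / 8 / r)) with (eps / 8) by (field; lra).
    pose proof (Cmod_ge_0 (q z)); nra.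
Qed.

(** Subtracting L / (z - p) leaves a function whose product with z - p tends to 0. The integral of 1
    / (z - p) stays unevaluated. *)
Lemma rectint_residue (q : C -> C) (a b c d : R) (p L : C) :
  a < Re p < b -> c < Im p < d ->
  holomorphic_in (fun z => in_rect a b c d z /\ z <> p) q ->
  clim (fun z => (z - p) * q z)%C p L ->
  rectint q a b c d = (L * rectint (fun z => / (z - p)) a b c d)%C.
Proof.
  intros Hx Hy Hq Hlim.
  assert (Hinv : forall z, z <> p -> exists l, cderiv (fun z => / (z - p))%C z l).
  { intros z Hz; eexists; apply cderiv_inv; [now apply Cminus_eq_contra|].
    apply cderiv_minus; [apply cderiv_id|apply cderiv_const]. }
  assert (Hb : forall z, on_rect a b c d z -> in_rect a b c d z /\ z <> p).
  { intros z Hz; split; [apply on_rect_in; [lra|lra|easy]|].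
    intros ->; destruct Hz; lra. }
  assert (E : rectint (fun z => q z + - L * / (z - p))%C a b c d = 0).
  { apply rectint_exceptional with p; try easy.
    - intros z Hz; destruct (Hq z Hz) as [l Hl].
      destruct (Hinv z (proj2 Hz)) as [m Hm].
      eexists; apply cderiv_plus; [exact Hl|].
      apply cderiv_mult; [apply cderiv_const|exact Hm].
    - apply clim_ext_all with (fun z => (z - p) * q z - L)%C.
      { intros z Hz; field; now apply Cminus_eq_contra. }
      replace (RtoC 0) with (L - L)%C by ring.
      apply clim_minus; [easy|apply clim_const]. }
  rewrite rectint_linear in E; try lra.
  - apply Ceq_minus; rewrite <- E; ring.
  - intros z Hz; apply (holomorphic_clim _ q z Hq (Hb z Hz)).
  - intros z Hz; destruct (Hinv z (proj2 (Hb z Hz))) as [l Hl].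
    apply (cderiv_clim _ _ _ Hl).
Qed.

Lemma RInt_Poisson_pos (a b k l : R) (g : R -> R) :
  a < b -> 0 < k -> (forall x, g x = k / (x ^ 2 + k ^ 2)) ->
  is_RInt g a b l -> 0 < l.
Proof.
  intros Hab Hk Hg Hl; rewrite <- (is_RInt_unique _ _ _ _ Hl).
  apply RInt_gt_0; [easy| |].
  - intros x _; rewrite Hg; apply Rdiv_lt_0_compat; nra.
  - intros x _; apply continuous_ext with (fun x => k / (x ^ 2 + k ^ 2)); [easy|].
    apply (ex_derive_continuous (K := R_AbsRing) (V := R_NormedModule)).
    auto_derive; nra.
Qed.

(** The imaginary part is positive: a side at distance k from 0 contributes, once its orientation is
    counted, the integral of k / (x^2 + k^2). *)
Lemma winding_neq_0 (a b c d : R) :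
  a < 0 < b -> c < 0 < d -> rectint (fun z => / (z - 0))%C a b c d <> 0.
Proof.
  intros Hab Hcd E.
  assert (F : cont_on_rect (fun z => / (z - 0))%C a b c d).
  { intros z Hz; apply (clim_inv (fun z => z - 0))%C.
    - replace (z - 0)%C with z by ring; intros ->; destruct Hz as [H|H]; simpl in H; lra.
    - apply clim_minus; [apply clim_id|apply clim_const]. }
  destruct (rectint_sides _ a b c d ltac:(lra) ltac:(lra) F) as [F1 [F2 [F3 F4]]].
  unfold rectint in E; cbv beta in E, F1, F2, F3, F4.
  set (I1 := CInt (fun x => / ((x, c) - 0))%C a b) in *.
  set (I2 := CInt (fun x => / ((x, d) - 0))%C a b) in *.
  set (I3 := CInt (fun y => / ((a, y) - 0))%C c d) in *.
  set (I4 := CInt (fun y => / ((b, y) - 0))%C c d) in *.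
  clearbody I1 I2 I3 I4.
  apply is_CInt_pair in F1 as [_ F1], F2 as [_ F2], F3 as [F3 _], F4 as [F4 _].
  assert (E' := f_equal Im E).
  unfold Cminus in E'; rewrite !im_plus, !im_opp, im_mult, !re_plus, !re_opp, im_RtoC in E'.
  change (Re Ci) with 0 in E'; change (Im Ci) with 1 in E'.
  apply (is_RInt_opp (V := R_NormedModule)) in F2, F3.
  apply RInt_Poisson_pos with (k := - c) in F1; try lra.
  apply RInt_Poisson_pos with (k := d) in F2; try lra.
  apply RInt_Poisson_pos with (k := - a) in F3; try lra.
  apply RInt_Poisson_pos with (k := b) in F4; try lra.
  - change (0 < - Im I2) in F2; change (0 < - Re I3) in F3; lra.
  - intros y; simpl; field; nra.
  - intros y; simpl; unfold opp; simpl; field; nra.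
  - intros x; simpl; unfold opp; simpl; field; nra.
  - intros x; simpl; field; nra.
Qed.

(** This replaces taking n-th roots: if x > y, the powers of x / y are unbounded and exceed k /
    j. *)
Lemma pow_compare (x y j k : R) :
  0 < y -> 0 < j -> (forall n, x ^ n * j <= k * y ^ n) -> x <= y.
Proof.
  intros Hy Hj H; apply Rnot_lt_le; intros Hxy.
  assert (Hq : 1 < x / y).
  { apply Rmult_lt_reg_r with y; [easy|]. unfold Rdiv; rewrite Rmult_assoc, Rinv_l; lra. }
  assert (Hq' : Rabs (x / y) > 1) by (rewrite Rabs_pos_eq; lra).
  destruct (Pow_x_infinity _ Hq' (k / j + 1)) as [N HN].
  specialize (HN N (Nat.le_refl N)); specialize (H N).
  rewrite Rabs_pos_eq in HN by (apply pow_le; lra).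
  assert (Hyn : 0 < y ^ N) by now apply pow_lt.
  unfold Rdiv in HN; rewrite Rpow_mult_distr, pow_inv in HN.
  apply Rge_le, Rmult_le_compat_r with (r := y ^ N * j) in HN; [|nra].
  replace (x ^ N * / y ^ N * (y ^ N * j)) with (x ^ N * j) in HN by (field; lra).
  replace ((k * / j + 1) * (y ^ N * j)) with (k * y ^ N + y ^ N * j) in HN by (field; lra).
  nra.
Qed.

(** * The maximum principle *)

Lemma cderiv_pow (f : C -> C) (z l : C) (n : nat) :
  cderiv f z l -> exists m, cderiv (fun w => f w ^ n)%C z m.
Proof.
  intros Hf; induction n as [|n [m Hm]].
  - exists 0%C; exact (cderiv_const 1 z).
  - eexists; exact (cderiv_mult f (fun w => f w ^ n)%C z l m Hf Hm).
Qed.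

(** The vertical line through t / 2 separates the two singular points; the piece around t
    contributes 0 and the piece around 0 a residue. The disjunction, together with a' < 0 < b',
    records that a' and b' depend on a, b and t but not on q. *)
Lemma rectint_singularities (q : C -> C) (a b c d t : R) (L : C) :
  a < 0 < b -> c < 0 < d -> a < t < b -> t <> 0 ->
  holomorphic_in (fun z => in_rect a b c d z /\ z <> 0 /\ z <> t) q ->
  clim (fun z => (z - 0) * q z)%C 0 L ->
  clim (fun z => (z - t) * q z)%C t 0 ->
  exists a' b', a <= a' < 0 /\ 0 < b' <= b /\ (a' = a /\ b' = t / 2 \/ a' = t / 2 /\ b' = b) /\
    rectint q a b c d = (L * rectint (fun z => / (z - 0)) a' b' c d)%C.
Proof.
  intros Hab Hcd Ht Ht0 Hq H0 Hqt.
  assert (Hline : forall x, a <= x <= b ->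
    clim q (x, c) (q (x, c)) /\ clim q (x, d) (q (x, d))).
  { intros x Hx; split; apply (holomorphic_clim _ q _ Hq); unfold in_rect; simpl;
    (repeat split; try lra); intros E; apply (f_equal Im) in E; simpl in E; lra. }
  assert (Sub : forall a' b', a <= a' -> b' <= b -> forall z,
    in_rect a' b' c d z -> in_rect a b c d z) by (unfold in_rect; intros; lra).
  assert (Z : forall a' b', a <= a' < 0 -> 0 < b' <= b -> (t < a' \/ b' < t) ->
    rectint q a' b' c d = (L * rectint (fun z => / (z - 0)) a' b' c d)%C).
  { intros a' b' Ha Hb Hab'; apply rectint_residue; try easy; simpl; try lra.
    intros z [Hz Hz0]; apply Hq; split; [apply (Sub a' b'); easy || lra|split; [easy|]].
    intros ->; unfold in_rect in Hz; simpl in Hz; lra. }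
  assert (T : forall a' b', a <= a' < t -> t < b' <= b -> (0 < a' \/ b' < 0) ->
    rectint q a' b' c d = 0).
  { intros a' b' Ha Hb Hab'; apply rectint_exceptional with (RtoC t); try easy; simpl; try lra.
    intros z [Hz Hz0]; apply Hq; split; [apply (Sub a' b'); easy || lra|split; [|easy]].
    intros ->; unfold in_rect in Hz; simpl in Hz; lra. }
  destruct (Rtotal_order t 0) as [Hn|[Hn|Hn]]; [|easy|].
  - exists (t / 2), b; split; [lra|split; [lra|split; [lra|]]].
    rewrite (rectint_split_x q a (t / 2) b), (T a), (Z (t / 2)); try lra; [ring|exact Hline].
  - exists a, (t / 2); split; [lra|split; [lra|split; [lra|]]].
    rewrite (rectint_split_x q a (t / 2) b), (Z a), (T (t / 2)); try lra; [ring|exact Hline].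
Qed.

Lemma maximum_principle (K : C -> C) (a b c d t B : R) (L M : C) :
  a < 0 < b -> c < 0 < d -> a < t < b -> t <> 0 -> 0 < B ->
  holomorphic_in (fun z => in_rect a b c d z /\ z <> 0 /\ z <> t) K ->
  clim K 0 L -> clim K t M ->
  (forall z, on_rect a b c d z -> Cmod (K z) <= B) ->
  Cmod L <= B.
Proof.
  intros Hab Hcd Ht Ht0 HB HK HL HM Hbd.
  assert (Ht0' : RtoC t <> 0) by (intros E; apply RtoC_inj in E; easy).
  (* The distance from 0 to the boundary, which bounds the factor 1 / |z| there. *)
  set (rho := Rmin (Rmin (- a) b) (Rmin (- c) d)).
  assert (Hrho : 0 < rho) by (unfold rho, Rmin; repeat destruct (Rle_dec _ _); lra).
  assert (Hz : forall z, on_rect a b c d z -> rho <= Cmod z).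
  { intros z Hz; pose proof (re_le_Cmod z) as H1; pose proof (im_le_Cmod z) as H2.
    unfold rho, Rmin; unfold Rabs in H1, H2.
    destruct (Rcase_abs (Re z)), (Rcase_abs (Im z)); repeat destruct (Rle_dec _ _);
    destruct Hz as [[Hx [Hy|Hy]]|[Hy [Hx|Hx]]]; lra. }
  assert (Hon : forall z, on_rect a b c d z -> in_rect a b c d z /\ z <> 0 /\ z <> t).
  { intros z Hz'; split; [apply on_rect_in; [lra|lra|easy]|].
    split; intros ->; destruct Hz' as [H|H]; simpl in H; lra. }
  set (q := fun n z => (K z ^ n / z)%C).
  assert (Hq : forall n, holomorphic_in (fun z => in_rect a b c d z /\ z <> 0 /\ z <> t) (q n)).
  { intros n z Hz'; destruct (HK z Hz') as [l Hl].
    destruct (cderiv_pow K z l n Hl) as [m Hm].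
    eexists; apply cderiv_mult; [exact Hm|apply cderiv_inv; [easy|apply cderiv_id]]. }
  set (J := fun n => rectint (q n) a b c d).
  assert (HJ : exists j, 0 < j /\ forall n, Cmod L ^ n * j <= Cmod (J n)).
  { assert (Q0 : forall n, clim (fun z => (z - 0) * q n z)%C 0 (L ^ n)%C).
    { intros n; apply clim_ext_all with (fun z => K z ^ n)%C.
      { intros z Hz'; unfold q; field; easy. }
      now apply clim_pow. }
    assert (Qt : forall n, clim (fun z => (z - t) * q n z)%C t 0).
    { intros n; replace (RtoC 0) with ((t - t) * (M ^ n / t))%C by (field; easy).
      apply clim_mult; [apply clim_minus; [apply clim_id|apply clim_const]|].
      apply clim_div; [easy|now apply clim_pow|apply clim_id]. }
    set (w := fun a' b' => Cmod (rectint (fun z => / (z - 0))%C a' b' c d)).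
    assert (Hw : forall a' b', a' < 0 < b' -> 0 < w a' b').
    { intros a' b' H; apply Cmod_gt_0, winding_neq_0; easy. }
    (* The instance n = 0 only supplies a' and b', from which j is defined; the sign of t forces the
       same pair for every n. *)
    destruct (rectint_singularities (q 0%nat) a b c d t _ Hab Hcd Ht Ht0
      (Hq 0%nat) (Q0 0%nat) (Qt 0%nat))
      as [a' [b' [H1 [H2 [H3 _]]]]].
    exists (w a' b'); split; [apply Hw; lra|]; intros n.
    destruct (rectint_singularities (q n) a b c d t _ Hab Hcd Ht Ht0 (Hq n) (Q0 n) (Qt n))
      as [a1 [b1 [H4 [H5 [H6 E]]]]].
    unfold J; rewrite E, Cmod_mult, Cmod_pow; right; f_equal.
    unfold w; f_equal; f_equal; lra. }
  destruct HJ as [j [Hj HJ]].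
  apply pow_compare with j (2 * ((b - a) + (d - c)) / rho); [easy|easy|].
  intros n; apply Rle_trans with (1 := HJ n).
  replace (2 * (b - a + (d - c)) / rho * B ^ n)
    with (2 * (b - a + (d - c)) * (B ^ n / rho)) by (field; lra).
  unfold J; apply rectint_bound; [lra|lra| |].
  - intros z Hz'; apply (holomorphic_clim _ _ z (Hq n) (Hon z Hz')).
  - intros z Hz'; unfold q; rewrite Cmod_div, Cmod_pow by apply (Hon z Hz').
    apply Rmult_le_compat.
    + apply pow_le, Cmod_ge_0.
    + left; apply Rinv_0_lt_compat, Cmod_gt_0, Hon, Hz'.
    + apply pow_incr; split; [apply Cmod_ge_0|auto].
    + apply Rinv_le_contravar; auto.
Qed.

(** * The conformal map of the strip onto the disc *)

Definition cexp (z : C) : C := (exp (Re z) * cos (Im z), exp (Re z) * sin (Im z)).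

Lemma cexp_plus (z w : C) : cexp (z + w) = (cexp z * cexp w)%C.
Proof.
  unfold cexp; rewrite re_plus, im_plus, exp_plus, cos_plus, sin_plus.
  unfold Cmult; simpl; f_equal; ring.
Qed.

Lemma cexp_R (x : R) : cexp x = exp x.
Proof. unfold cexp, RtoC; simpl; rewrite cos_0, sin_0; f_equal; ring. Qed.

Lemma Rderiv_approx (f : R -> R) (x l eps : R) : 0 < eps -> is_derive f x l ->
  exists d, 0 < d /\ forall h, Rabs h < d ->
    Rabs (f (x + h) - f x - l * h) <= eps * Rabs h.
Proof.
  intros He Hf; apply is_derive_Reals in Hf; destruct (Hf eps He) as [d H].
  exists d; split; [apply cond_pos|]; intros h Hh.
  destruct (Req_dec h 0) as [->|Hh0].
  { rewrite Rplus_0_r, Rabs_R0; replace (f x - f x - l * 0) with 0 by ring.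
    rewrite Rabs_R0; lra. }
  replace (f (x + h) - f x - l * h) with (((f (x + h) - f x) / h - l) * h) by (now field).
  rewrite Rabs_mult; apply Rmult_le_compat_r; [apply Rabs_pos|].
  now left; apply H.
Qed.

Lemma cderiv_cexp_0 : cderiv cexp 0 1.
Proof.
  intros eps He.
  (* With e = eps / 16 and r = |z|, the real and imaginary parts of [cexp z - 1 - z] will be bounded
     by 5 e r and 6 e r, together less than eps r. *)
  assert (He4 : 0 < eps / 16) by lra.
  destruct (Rderiv_approx exp 0 1 (eps / 16) He4) as [d1 [Hd1 H1]].
  { auto_derive; [easy|rewrite exp_0; ring]. }
  destruct (Rderiv_approx cos 0 0 (eps / 16) He4) as [d2 [Hd2 H2]].
  { auto_derive; [easy|rewrite sin_0; ring]. }
  destruct (Rderiv_approx sin 0 1 (eps / 16) He4) as [d3 [Hd3 H3]].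
  { auto_derive; [easy|rewrite cos_0; ring]. }
  set (m := Rmin 1 (eps / 16)).
  exists (Rmin m (Rmin d1 (Rmin d2 d3))); split.
  { unfold m; repeat apply Rmin_pos; lra. }
  intros z Hz Hzd.
  replace (z - 0)%C with z in * by ring.
  assert (Hzp : 0 < Cmod z) by now apply Cmod_gt_0.
  pose proof (re_le_Cmod z) as Hx; pose proof (im_le_Cmod z) as Hy.
  set (x := Re z) in *; set (y := Im z) in *.
  assert (D : Cmod z < m /\ Cmod z < d1 /\ Cmod z < d2 /\ Cmod z < d3).
  { revert Hzd; unfold Rmin at 1 2 3; repeat destruct (Rle_dec _ _); lra. }
  assert (Dm : m <= 1 /\ m <= eps / 16).
  { unfold m; split; [apply Rmin_l|apply Rmin_r]. }
  specialize (H1 x ltac:(lra)); specialize (H2 y ltac:(lra)); specialize (H3 y ltac:(lra)).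
  rewrite !Rplus_0_l, ?exp_0, ?cos_0, ?sin_0 in *.
  set (u := exp x - 1 - 1 * x) in *; set (v := cos y - 1 - 0 * y) in *.
  set (w := sin y - 0 - 1 * y) in *.
  assert (Ex : exp x = 1 + x + u) by (unfold u; ring).
  assert (Ey : cos y = 1 + v) by (unfold v; ring).
  assert (Ew : sin y = y + w) by (unfold w; ring).
  rewrite cexp_R, exp_0.
  replace ((cexp z - 1) / z - 1)%C with ((cexp z - 1 - z) / z)%C by (now field).
  rewrite Cmod_div by easy.
  apply Rmult_lt_reg_r with (Cmod z); [easy|].
  unfold Rdiv; rewrite Rmult_assoc, Rinv_l, Rmult_1_r by lra.
  set (r := Cmod z) in *.
  assert (Hu : Rabs u <= eps / 16 * r) by nra.
  assert (Hv : Rabs v <= eps / 16 * r) by nra.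
  assert (Hw : Rabs w <= eps / 16 * r) by nra.
  apply Rle_lt_trans with (1 := Cmod_le_abs _).
  assert (R1 : Re (cexp z - 1 - z) = u + (v + (x * v + u * v))).
  { unfold cexp, Cminus; fold x y; rewrite !re_plus, !re_opp; unfold Re at 1; simpl fst.
    rewrite Ex, Ey; fold x; simpl; ring. }
  assert (I1 : Im (cexp z - 1 - z) = w + (x * y + (x * w + (u * y + u * w)))).
  { unfold cexp, Cminus; fold x y; rewrite !im_plus, !im_opp; unfold Im at 1; simpl snd.
    rewrite Ex, Ew; fold y; simpl; ring. }
  rewrite R1, I1.
  assert (P : forall s t e f, Rabs s <= e -> Rabs t <= f -> Rabs (s * t) <= e * f).
  { intros; rewrite Rabs_mult; apply Rmult_le_compat; try easy; apply Rabs_pos. }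
  set (e := eps / 16) in *.
  assert (Eeps : eps = 16 * e) by (unfold e; field).
  assert (Hr : r < 1) by lra. assert (Hre : r < e) by lra.
  assert (S : forall s t e f, Rabs s <= e -> Rabs t <= f -> Rabs (s + t) <= e + f).
  { intros s t f g Hs Ht; pose proof (Rabs_triang s t); lra. }
  (* In the products [u * v] and [u * w] the smallness comes from [u]; a crude bound on the other
     factor is enough. *)
  assert (V2 : Rabs v <= 2) by (unfold v; pose proof (COS_bound y); apply Rabs_le; lra).
  assert (W2 : Rabs w <= 2).
  { assert (Hy1 : Rabs y < 1) by lra; apply Rabs_def2 in Hy1.
    unfold w; pose proof (SIN_bound y); apply Rabs_le; lra. }
  clearbody u v w x y r e.
  assert (Re_bound : Rabs (u + (v + (x * v + u * v)))
    <= e * r + (e * r + (1 * (e * r) + e * r * 2))).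
  { repeat apply S; try apply P; easy || lra. }
  assert (Im_bound : Rabs (w + (x * y + (x * w + (u * y + u * w))))
    <= e * r + (e * r + (1 * (e * r) + (e * r * 1 + e * r * 2)))).
  { repeat apply S; try apply P; easy || lra. }
  nra.
Qed.

(** The functional equation of the exponential carries the derivative from 0 to z. *)
Lemma cderiv_cexp (z : C) : cderiv cexp z (cexp z).
Proof.
  apply clim_ext_all with
    (fun w => cexp z * ((cexp (1 * w + - z) - cexp 0) / (1 * w + - z - 0)))%C.
  { intros w Hw. replace (cexp w) with (cexp z * cexp (1 * w + - z))%C.
    - rewrite cexp_R, exp_0; replace (1 * w + - z - 0)%C with (w - z)%C by ring.
      field; now apply Cminus_eq_contra.
    - rewrite <- cexp_plus; f_equal; ring. }
  replace (cexp z) with (cexp z * 1)%C at 1 by ring.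
  apply clim_mult; [apply clim_const|].
  intros eps He; destruct (cderiv_cexp_0 eps He) as [d [Hd H]].
  exists d; split; [easy|]; intros w Hw Hwz; apply H.
  - intros E; apply (Cminus_eq_contra w z Hw); rewrite <- E; ring.
  - replace (1 * w + - z - 0)%C with (w - z)%C by ring; easy.
Qed.

(* T(z) = tanh(z/4); the exponent has the form [k * z + m] of [cderiv_affine]. *)
Definition tanh4 (z : C) : C :=
  ((cexp (RtoC (/ 2) * z + 0) - 1) / (cexp (RtoC (/ 2) * z + 0) + 1))%C.

Lemma half_neq_0 : RtoC (/ 2) <> 0.
Proof. intros E; apply RtoC_inj in E; lra. Qed.

Lemma cexp_half (z : C) : cexp (RtoC (/ 2) * z + 0)
  = (exp (Re z / 2) * cos (Im z / 2), exp (Re z / 2) * sin (Im z / 2)).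
Proof.
  unfold cexp; rewrite re_plus, im_plus, re_scal_l, im_scal_l; simpl.
  rewrite !Rplus_0_r; unfold Rdiv; now rewrite !(Rmult_comm (/ 2)).
Qed.

Lemma strip_half (z : C) : strip z -> - (PI / 2) < Im z / 2 < PI / 2.
Proof. unfold strip; intros H; apply Rabs_def2 in H; lra. Qed.

Lemma cexp_half_plus_1 (z : C) : strip z -> (cexp (RtoC (/ 2) * z + 0) + 1)%C <> 0.
Proof.
  intros Hz E; apply (f_equal Re) in E; rewrite cexp_half in E; simpl in E.
  apply strip_half in Hz; pose proof (exp_pos (Re z / 2)).
  pose proof (cos_gt_0 (Im z / 2) ltac:(lra) ltac:(lra)); nra.
Qed.

Lemma cderiv_cexp_half (z : C) : cderiv (fun w => cexp (RtoC (/ 2) * w + 0)) z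
  (RtoC (/ 2) * cexp (RtoC (/ 2) * z + 0)).
Proof. apply (cderiv_affine cexp); [apply half_neq_0|apply cderiv_cexp]. Qed.

Lemma tanh4_holo (z : C) : strip z -> exists l, cderiv tanh4 z l.
Proof.
  intros Hz; eexists; apply cderiv_mult; [|apply cderiv_inv];
    [| now apply cexp_half_plus_1 |].
  - apply cderiv_minus; [apply cderiv_cexp_half|apply cderiv_const].
  - apply cderiv_plus; [apply cderiv_cexp_half|apply cderiv_const].
Qed.

Lemma tanh4_slope_0 : clim (fun z => tanh4 z / z)%C 0 (RtoC (/ 4)).
Proof.
  assert (E0 : cexp (RtoC (/ 2) * 0 + 0) = 1).
  { rewrite cexp_half; simpl. replace (0 / 2) with 0 by field.
    rewrite exp_0, cos_0, sin_0; unfold RtoC; f_equal; ring. }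
  apply clim_ext_all with (fun z =>
    ((cexp (RtoC (/ 2) * z + 0) - cexp (RtoC (/ 2) * 0 + 0)) / (z - 0))
    / (cexp (RtoC (/ 2) * z + 0) + 1))%C.
  { intros z Hz; rewrite E0; unfold tanh4, Cdiv.
    replace (z - 0)%C with z by ring; ring. }
  assert (H2 : RtoC 2 <> 0) by (intros E; apply RtoC_inj in E; lra).
  replace (RtoC (/ 4)) with (RtoC (/ 2) * cexp (RtoC (/ 2) * 0 + 0) / 2)%C.
  2: { rewrite E0, <- RtoC_mult, <- RtoC_div by lra; f_equal; field. }
  apply clim_div; [easy|apply cderiv_cexp_half|].
  replace (RtoC 2) with (cexp (RtoC (/ 2) * 0 + 0) + 1)%C.
  2: { rewrite E0, <- RtoC_plus; reflexivity. }
  apply clim_plus; [|apply clim_const].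
  apply (cderiv_clim _ _ _ (cderiv_cexp_half 0)).
Qed.

(** Here e^(z/2) has modulus r and real part r k, so |e^(z/2) + 1|^2 and |e^(z/2) - 1|^2 are r^2 + 1
    + 2 r k and r^2 + 1 - 2 r k. *)
Lemma tanh4_mod (z : C) : strip z ->
  let r := exp (Re z / 2) in let k := cos (Im z / 2) in
  Cmod (tanh4 z) ^ 2 * (r ^ 2 + 1 + 2 * r * k) = r ^ 2 + 1 - 2 * r * k.
Proof.
  intros Hz r k.
  assert (S : sin (Im z / 2) ^ 2 = 1 - k ^ 2).
  { pose proof (sin2_cos2 (Im z / 2)) as H; unfold Rsqr in H; fold k in H; nra. }
  assert (N1 : Cmod (cexp (RtoC (/ 2) * z + 0) + 1) ^ 2 = r ^ 2 + 1 + 2 * r * k).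
  { rewrite Cmod2_alt, cexp_half; simpl; fold r k.
    transitivity (r ^ 2 * (k ^ 2 + sin (Im z / 2) ^ 2) + 1 + 2 * r * k); [ring|rewrite S; ring]. }
  assert (N2 : Cmod (cexp (RtoC (/ 2) * z + 0) - 1) ^ 2 = r ^ 2 + 1 - 2 * r * k).
  { rewrite Cmod2_alt, cexp_half; simpl; fold r k.
    transitivity (r ^ 2 * (k ^ 2 + sin (Im z / 2) ^ 2) + 1 - 2 * r * k); [ring|rewrite S; ring]. }
  rewrite <- N1, <- N2, <- Rpow_mult_distr, <- Cmod_mult; unfold tanh4.
  f_equal; f_equal; field; now apply cexp_half_plus_1.
Qed.

Lemma tanh4_neq_0 (z : C) : strip z -> z <> 0 -> tanh4 z <> 0.
Proof.
  intros Hz Hz0 E; pose proof (tanh4_mod z Hz) as H; simpl in H.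
  rewrite E, Cmod_0 in H; apply Hz0; apply strip_half in Hz.
  set (r := exp (Re z / 2)) in *; set (k := cos (Im z / 2)) in *.
  assert (Hr : 0 < r) by apply exp_pos.
  assert (Hk : k <= 1) by apply COS_bound.
  (* [H] now reads r^2 + 1 = 2 r k, and k <= 1 turns this into (r - 1)^2 <= 0. *)
  assert (Hr1 : r = 1) by nra.
  assert (Hk1 : k = 1) by nra.
  destruct z as [x y]; simpl in *.
  assert (Hx : x = 0).
  { unfold r in Hr1; rewrite <- exp_0 in Hr1; apply exp_inv in Hr1; lra. }
  assert (Hy : y = 0).
  { destruct (Rtotal_order y 0) as [Hy|[Hy|Hy]]; [|easy|]; exfalso.
    - assert (k < cos 0); [|rewrite cos_0 in *; lra].
      unfold k; rewrite <- cos_neg; apply cos_decreasing_1; lra.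
    - assert (k < cos 0); [|rewrite cos_0 in *; lra].
      unfold k; apply cos_decreasing_1; lra. }
  now rewrite Hx, Hy.
Qed.

Lemma exp_monotone (x y : R) : x <= y -> exp x <= exp y.
Proof. intros [H| ->]; [left; now apply exp_increasing|apply Rle_refl]. Qed.

Lemma tanh4_boundary (B : R) : 1 < B -> exists R0 c0 : R, 0 < R0 /\ 0 < c0 < PI /\
  (forall z : C, strip z -> R0 <= Rabs (Re z) \/ c0 <= Rabs (Im z) ->
    1 <= B * Cmod (tanh4 z) ^ 2).
Proof.
  intros HB.
  (* Chosen so that (1 - d) / (1 + d) = 1 / B: by [tanh4_mod], the inequality 2 r k <= d (r^2 + 1)
     then gives |T|^2 >= 1 / B. *)
  set (d := (B - 1) / (B + 1)).
  assert (Hd : d * (B + 1) = B - 1) by (unfold d; field; lra).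
  assert (Hd0 : 0 < d) by nra. assert (Hd1 : d < 1) by nra.
  pose proof PI2_3_2 as HPI.
  assert (Hln : 0 < ln (2 / d)).
  { rewrite <- ln_1; apply ln_increasing; [lra|].
    apply Rmult_lt_reg_r with d; [lra|]; unfold Rdiv; rewrite Rmult_assoc, Rinv_l; lra. }
  (* If |Re z| >= 2 ln (2 / d), then r <= d / 2 or r >= 2 / d; if |Im z| >= PI - d, then k = sin
     ((PI - |Im z|) / 2) <= d. Either case yields 2 r k <= d (r^2 + 1). *)
  exists (2 * ln (2 / d)), (PI - d); split; [lra|]; split; [lra|].
  intros z Hz Hb; pose proof (tanh4_mod z Hz) as H; simpl in H.
  apply strip_half in Hz as Hz'.
  set (r := exp (Re z / 2)) in *; set (k := cos (Im z / 2)) in *.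
  assert (Hr : 0 < r) by apply exp_pos.
  assert (Hk0 : 0 < k) by (apply cos_gt_0; lra).
  assert (Hk : k <= 1) by apply COS_bound.
  assert (Hm : 2 * r * k <= d * (r ^ 2 + 1)).
  { destruct Hb as [Hb|Hb].
    - assert (2 * r <= d * (r ^ 2 + 1)); [|nra].
      unfold Rabs in Hb; destruct (Rcase_abs (Re z)).
      + assert (E : r <= d / 2).
        { replace (d / 2) with (exp (- ln (2 / d))).
          - apply exp_monotone; lra.
          - rewrite exp_Ropp, exp_ln; [field; lra|]. apply Rdiv_lt_0_compat; lra. }
        nra.
      + assert (E : 2 / d <= r).
        { rewrite <- (exp_ln (2 / d)) by (apply Rdiv_lt_0_compat; lra).
          apply exp_monotone; lra. }
        assert (2 <= d * r); [|nra].
        apply Rmult_le_compat_l with (r := d) in E; [|lra].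
        replace (d * (2 / d)) with 2 in E by (field; lra); lra.
    - assert (E : k <= d).
      2: { pose proof (Rmult_le_pos r (d - k)); pose proof (Rmult_le_pos d ((r - 1) ^ 2));
           pose proof (pow2_ge_0 (r - 1)); nra. }
      assert (K : k = sin (PI / 2 - Rabs (Im z) / 2)).
      { rewrite sin_shift; unfold k, Rabs; destruct (Rcase_abs (Im z)); [|easy].
        rewrite <- cos_neg; f_equal; field. }
      rewrite K.
      assert (0 < PI / 2 - Rabs (Im z) / 2).
      { unfold strip in Hz; lra. }
      left; apply Rlt_le_trans with (PI / 2 - Rabs (Im z) / 2); [now apply sin_lt_x|lra]. }
  set (T := Cmod (tanh4 z) * (Cmod (tanh4 z) * 1)) in *.
  assert (HT : T * (r * (r * 1) + 1 + 2 * r * k) * B >= r * (r * 1) + 1 + 2 * r * k).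
  { rewrite H. set (s := r * (r * 1) + 1) in *.
    assert (s = r ^ 2 + 1) by (unfold s; ring). nra. }
  assert (Hp : 0 < r * (r * 1) + 1 + 2 * r * k) by nra.
  apply Rmult_le_reg_r with (r * (r * 1) + 1 + 2 * r * k); [easy|].
  simpl; fold T; lra.
Qed.

Lemma tanh4_R (t : R) : tanh4 t = (exp (t / 2) - 1) / (exp (t / 2) + 1).
Proof.
  assert (H : 0 < exp (t / 2)) by apply exp_pos.
  rewrite RtoC_div, RtoC_minus, RtoC_plus by lra; unfold tanh4.
  replace (cexp (RtoC (/ 2) * t + 0)) with (RtoC (exp (t / 2))); [easy|].
  rewrite cexp_half; simpl; replace (0 / 2) with 0 by field.
  rewrite cos_0, sin_0; unfold RtoC; f_equal; ring.
Qed.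

(** * The Schwarz lemma on the strip *)

(** The rectangle has half-width R0 + |t| and half-height c0: it contains 0 and t, and all its sides
    lie where |K| <= 1 + eps. *)
Lemma strip_maximum_principle (K : C -> C) (t : R) (L M : C) :
  t <> 0 -> holomorphic_in (fun z => strip z /\ z <> 0 /\ z <> t) K ->
  clim K 0 L -> clim K t M ->
  (forall B, 1 < B -> exists R0 c0 : R, 0 < R0 /\ 0 < c0 < PI /\
    forall z, strip z -> R0 <= Rabs (Re z) \/ c0 <= Rabs (Im z) -> Cmod (K z) <= B) ->
  Cmod L <= 1.
Proof.
  intros Ht HK HL HM Hbd; apply le_epsilon; intros eps He.
  destruct (Hbd (1 + eps)) as [R0 [c0 [HR [Hc H]]]]; [lra|].
  pose proof (Rabs_pos t) as Hta; pose proof (Rle_abs t) as Ht1.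
  pose proof (Rle_abs (- t)) as Ht2; rewrite Rabs_Ropp in Ht2.
  set (r := R0 + Rabs t) in *.
  assert (Hst : forall z, in_rect (- r) r (- c0) c0 z -> strip z).
  { intros z [_ Hz]; unfold strip; apply Rle_lt_trans with c0; [apply Rabs_le|]; lra. }
  apply (maximum_principle K (- r) r (- c0) c0 t (1 + eps) L M);
    try (unfold r; lra); try easy.
  - intros z [Hz Hz']; apply HK; auto.
  - intros z Hz; apply H; [apply Hst, on_rect_in; unfold r in *; try lra; easy|].
    destruct Hz as [[_ [Hz|Hz]]|[_ [Hz|Hz]]]; rewrite Hz; [right|right|left|left];
      rewrite ?Rabs_Ropp, Rabs_pos_eq; unfold r; lra.
Qed.

(** This is l'Hopital's rule at a simple zero of g; the non-zero derivative m also keeps g from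
    vanishing near p. *)
Lemma clim_quotient_zeros (f g : C -> C) (p l m : C) :
  f p = 0 -> g p = 0 -> m <> 0 -> cderiv f p l -> cderiv g p m ->
  clim (fun z => f z / g z)%C p (l / m)%C.
Proof.
  intros Hf Hg Hm Hl Hm'.
  destruct (clim_neq_0 _ p m Hm Hm') as [d [Hd H]].
  apply clim_ext with (fun z => ((f z - f p) / (z - p)) / ((g z - g p) / (z - p)))%C d;
    [easy| |now apply clim_div].
  intros z Hz Hzd; specialize (H z Hz Hzd); rewrite Hf, Hg in *.
  assert (Hzp : (z - p)%C <> 0) by now apply Cminus_eq_contra.
  assert (Hgz : g z <> 0).
  { intros E; apply H; rewrite E; field; easy. }
  replace (f z - 0)%C with (f z) by ring; replace (g z - 0)%C with (g z) by ring.
  field; easy.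
Qed.

(** The limit may be approached along the real axis. Applied to difference quotients, this makes the
    derivative of theta at 0 real. *)
Lemma clim_real (f : C -> C) (p : R) (L : C) :
  (forall x : R, x <> p -> Im (f x) = 0) -> clim f p L -> Im L = 0.
Proof.
  intros Hf HL; apply NNPP; intros Hne.
  destruct (HL (Rabs (Im L))) as [d [Hd H]]; [now apply Rabs_pos_lt|].
  assert (Hx : p + d / 2 <> p) by lra.
  specialize (H (RtoC (p + d / 2)) ltac:(intros E; apply RtoC_inj in E; easy)).
  rewrite <- RtoC_minus, Cmod_R, Rabs_pos_eq in H by lra.
  specialize (H ltac:(lra)).
  pose proof (im_le_Cmod (f (RtoC (p + d / 2)) - L)) as Hi.
  unfold Cminus in Hi; rewrite im_plus, im_opp, Hf, Rplus_0_l, Rabs_Ropp in Hi by easy.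
  unfold Cminus in H; lra.
Qed.

Lemma tanh4_0 : tanh4 0 = 0.
Proof.
  rewrite tanh4_R; f_equal. replace (0 / 2) with 0 by field; rewrite exp_0; field.
Qed.

Lemma cderiv_tanh4_0 : cderiv tanh4 0 (RtoC (/ 4)).
Proof.
  apply clim_ext_all with (fun z => tanh4 z / z)%C; [|apply tanh4_slope_0].
  intros z Hz; rewrite tanh4_0; field; easy.
Qed.

(** The translation is written in the form required by [cderiv_affine]. *)
Definition tanh4_at (t : R) (z : C) : C := tanh4 (1 * z + - t)%C.

Lemma strip_shift (t : R) (z : C) : strip z -> strip (1 * z + - t)%C.
Proof.
  unfold strip; intros Hz; rewrite im_plus, im_opp, im_RtoC, im_scal_l.
  now replace (1 * Im z + - 0) with (Im z) by ring.
Qed.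

Lemma tanh4_at_holo (t : R) (z : C) : strip z -> exists l, cderiv (tanh4_at t) z l.
Proof.
  intros Hz; destruct (tanh4_holo _ (strip_shift t z Hz)) as [l Hl].
  eexists; apply (cderiv_affine tanh4 1 (- t)%C z l); [apply C1_nz|exact Hl].
Qed.

Lemma tanh4_at_neq_0 (t : R) (z : C) : strip z -> z <> t -> tanh4_at t z <> 0.
Proof.
  intros Hz Hzt; apply tanh4_neq_0; [now apply strip_shift|].
  intros E; apply Hzt; replace z with (1 * z + - t + t)%C by ring; rewrite E; ring.
Qed.

Lemma tanh4_at_zero (t : R) : tanh4_at t t = 0.
Proof.
  unfold tanh4_at; replace (1 * t + - t)%C with (RtoC 0) by ring; apply tanh4_0.
Qed.

Lemma cderiv_tanh4_at (t : R) : cderiv (tanh4_at t) t (RtoC (/ 4)).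
Proof.
  replace (RtoC (/ 4)) with (1 * RtoC (/ 4))%C by ring.
  apply (cderiv_affine tanh4); [apply C1_nz|].
  replace (1 * t + - t)%C with (RtoC 0) by ring; apply cderiv_tanh4_0.
Qed.

Lemma quarter_neq_0 : RtoC (/ 4) <> 0.
Proof. intros E; apply RtoC_inj in E; lra. Qed.

Lemma strip_R (x : R) : strip x.
Proof. unfold strip; rewrite im_RtoC, Rabs_R0; apply PI_RGT_0. Qed.

Lemma quotient_bound (x y B : R) : 0 <= x <= 1 -> 0 < y -> 0 < B -> 1 <= B * y -> x / y <= B.
Proof.
  intros Hx Hy HB H; apply Rmult_le_reg_r with y; [easy|].
  unfold Rdiv; rewrite Rmult_assoc, Rinv_l; lra.
Qed.

Lemma neq_0_of_square_bound (B : R) (w : C) : 1 <= B * Cmod w ^ 2 -> w <> 0.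
Proof. intros H ->; rewrite Cmod_0 in H; lra. Qed.

Lemma over_tanh4_holo (F : C -> C) :
  holomorphic_in strip F ->
  holomorphic_in (fun z => strip z /\ z <> 0) (fun z => F z / tanh4 z)%C.
Proof.
  intros F_holo z [Hz Hz0]; destruct (F_holo z Hz) as [m Hm].
  destruct (tanh4_holo z Hz) as [m' Hm'].
  eexists; apply cderiv_mult; [exact Hm|apply cderiv_inv; [|exact Hm']].
  now apply tanh4_neq_0.
Qed.

Lemma over_tanh4_clim_0 (F : C -> C) (l : C) :
  F 0 = 0 -> cderiv F 0 l -> clim (fun z => F z / tanh4 z)%C 0 (l / RtoC (/ 4))%C.
Proof.
  intros; apply clim_quotient_zeros;
    auto using tanh4_0, quarter_neq_0, cderiv_tanh4_0.
Qed.

Lemma strip_Schwarz (F : C -> C) (l : C) :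
  holomorphic_in strip F -> (forall z, strip z -> Cmod (F z) <= 1) ->
  F 0 = 0 -> cderiv F 0 l ->
  Cmod (l / RtoC (/ 4)) <= 1.
Proof.
  intros F_holo F_le1 F_0 F_deriv.
  (* There is a single zero here, so the second point of the maximum principle is filled by 1, an
     arbitrary non-zero real at which the quotient is holomorphic. *)
  assert (H1 : strip 1 /\ RtoC 1 <> 0) by (split; [apply strip_R|apply C1_nz]).
  apply (strip_maximum_principle _ 1 _ (F 1 / tanh4 1)%C R1_neq_R0)
    with (3 := holomorphic_clim _ _ _ (over_tanh4_holo F F_holo) H1).
  - intros z Hz; apply over_tanh4_holo; easy.
  - now apply over_tanh4_clim_0.
  - intros B HB; destruct (tanh4_boundary B HB) as [R0 [c0 [HR [Hc H]]]].
    exists R0, c0; split; [easy|split; [easy|]]; intros z Hz Hz'.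
    specialize (H z Hz Hz').
    assert (Hp : 0 < Cmod (tanh4 z)).
    { now apply Cmod_gt_0, (neq_0_of_square_bound B). }
    rewrite Cmod_div by now apply Cmod_gt_0.
    apply quotient_bound; try easy; try lra.
    + split; [apply Cmod_ge_0|now apply F_le1].
    + assert (1 <= (B * Cmod (tanh4 z)) ^ 2); [|nra].
      replace ((B * Cmod (tanh4 z)) ^ 2) with (B * (B * Cmod (tanh4 z) ^ 2)) by ring; nra.
Qed.

Lemma strip_Schwarz_two_zeros (F : C -> C) (l : C) (t : R) :
  holomorphic_in strip F -> (forall z, strip z -> Cmod (F z) <= 1) ->
  F 0 = 0 -> cderiv F 0 l ->
  t <> 0 -> F t = 0 ->
  Cmod (l / RtoC (/ 4)) <= Cmod (tanh4_at t 0).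
Proof.
  intros F_holo F_le1 F_0 F_deriv Ht HFt.
  assert (Ht' : RtoC t <> 0) by (intros E; apply RtoC_inj in E; easy).
  assert (HT0 : tanh4_at t 0 <> 0).
  { apply tanh4_at_neq_0; [apply strip_R|auto]. }
  assert (HTt : tanh4 t <> 0) by (apply tanh4_neq_0; [apply strip_R|easy]).
  enough (H : Cmod (l / RtoC (/ 4) / tanh4_at t 0) <= 1).
  { rewrite Cmod_div in H by easy; apply Cmod_gt_0 in HT0.
    apply Rmult_le_compat_r with (r := Cmod (tanh4_at t 0)) in H; [|lra].
    unfold Rdiv in H; rewrite Rmult_assoc, Rinv_l in H; lra. }
  destruct (F_holo t (strip_R t)) as [m Hm].
  apply (strip_maximum_principle (fun z => F z / tanh4 z / tanh4_at t z)%C t _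
    (m / RtoC (/ 4) / tanh4 t)%C Ht).
  - intros z [Hz [Hz0 Hzt]]; destruct (over_tanh4_holo F F_holo z (conj Hz Hz0)) as [u Hu].
    destruct (tanh4_at_holo t z Hz) as [v Hv].
    eexists; apply cderiv_mult; [exact Hu|apply cderiv_inv; [|exact Hv]].
    now apply tanh4_at_neq_0.
  - apply clim_div; [easy|now apply over_tanh4_clim_0|].
    destruct (tanh4_at_holo t 0 (strip_R 0)) as [v Hv]; apply (cderiv_clim _ _ _ Hv).
  (* At t it is [tanh4_at t] that vanishes together with [F], so this factor is divided out
     first. *)
  - apply clim_ext_all with (fun z => F z / tanh4_at t z / tanh4 z)%C.
    { intros z _; unfold Cdiv; ring. }
    apply clim_div; [easy| |].
    + apply clim_quotient_zeros; auto using tanh4_at_zero, quarter_neq_0, cderiv_tanh4_at.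
    + destruct (tanh4_holo t (strip_R t)) as [v Hv]; apply (cderiv_clim _ _ _ Hv).
  - intros B HB; destruct (tanh4_boundary B HB) as [R0 [c0 [HR [Hc H]]]].
    pose proof (Rabs_pos t) as Hta.
    (* The margin |t| puts z and z - t both in the region where [tanh4_boundary] applies. *)
    exists (R0 + Rabs t), c0; split; [lra|split; [easy|]]; intros z Hz Hz'.
    assert (H1 : 1 <= B * Cmod (tanh4 z) ^ 2).
    { apply H; [easy|]; destruct Hz'; [left; lra|now right]. }
    assert (H2 : 1 <= B * Cmod (tanh4_at t z) ^ 2).
    { apply H; [now apply strip_shift|].
      rewrite im_plus, im_opp, im_RtoC, im_scal_l, re_plus, re_opp, re_RtoC, re_scal_l.
      replace (1 * Im z + - 0) with (Im z) by ring.
      replace (1 * Re z + - t) with (Re z - t) by ring.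
      destruct Hz' as [Hz'|Hz']; [left|now right].
      pose proof (Rabs_triang_inv (Re z) t); lra. }
    set (x := Cmod (tanh4 z)) in *; set (y := Cmod (tanh4_at t z)) in *.
    assert (Hx : 0 < x) by (now apply Cmod_gt_0, (neq_0_of_square_bound B)).
    assert (Hy : 0 < y) by (now apply Cmod_gt_0, (neq_0_of_square_bound B)).
    rewrite !Cmod_div by now apply Cmod_gt_0.
    fold x y. replace (Cmod (F z) / x / y) with (Cmod (F z) / (x * y)) by (field; lra).
    apply quotient_bound; try lra.
    + split; [apply Cmod_ge_0|now apply F_le1].
    + now apply Rmult_lt_0_compat.
    + assert (0 < x * y) by nra.
      (* Since the bounds concern the squares x^2 and y^2, their product controls x y with the same
         B. *)
      assert (1 <= (B * (x * y)) ^ 2); [|nra].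
      replace ((B * (x * y)) ^ 2) with ((B * x ^ 2) * (B * y ^ 2)) by ring; nra.
Qed.

(** * Normalisation at 0 and the logarithmic form of the bound *)

Lemma Mobius_bound (a : R) (w : C) :
  Rabs a < 1 -> Cmod w < 1 ->
  (1 - a * w)%C <> 0 /\ Cmod ((w - a) / (1 - a * w)) <= 1.
Proof.
  intros Ha Hw.
  assert (Hn : (1 - a * w)%C <> 0).
  { intros E; apply Ceq_minus in E; apply (f_equal Cmod) in E.
    rewrite Cmod_1, Cmod_mult, Cmod_R in E.
    pose proof (Cmod_ge_0 w); pose proof (Rabs_pos a); nra. }
  split; [easy|]; rewrite Cmod_div by easy.
  assert (Hp : 0 < Cmod (1 - a * w)) by now apply Cmod_gt_0.
  apply Rmult_le_reg_r with (Cmod (1 - a * w)); [easy|].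
  unfold Rdiv; rewrite Rmult_assoc, Rinv_l, Rmult_1_r, Rmult_1_l by lra.
  apply Rsqr_incr_0; [|apply Cmod_ge_0|lra].
  rewrite !Rsqr_pow2, !Cmod2_alt.
  assert (Hw2 : Re w ^ 2 + Im w ^ 2 < 1).
  { rewrite <- Cmod2_alt; pose proof (Cmod_ge_0 w); nra. }
  assert (Ha2 : a ^ 2 < 1).
  { rewrite <- pow2_abs; pose proof (Rabs_pos a); nra. }
  unfold Cminus; rewrite !re_plus, !im_plus, !re_opp, !im_opp, re_scal_l, im_scal_l,
    !re_RtoC, !im_RtoC.
  set (u := Re w) in *; set (v := Im w) in *.
  (* This product equals |1 - a w|^2 - |w - a|^2. *)
  assert (0 <= (1 - a ^ 2) * (1 - (u ^ 2 + v ^ 2))) by (apply Rmult_le_pos; lra).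
  nra.
Qed.

(** The fraction is T(-t), the value of T(z - t) at 0. With E = exp (|t| / 2) its modulus is (E - 1)
    / (E + 1) < 1, and |b| is at most this exactly when (1 + b) / (1 - b) lies between 1 / E and
    E. *)
Lemma log_ratio_bound (b t : R) :
  Rabs b <= Rabs ((exp (- t / 2) - 1) / (exp (- t / 2) + 1)) ->
  Rabs b < 1 /\ 2 * Rabs (ln ((1 + b) / (1 - b))) <= Rabs t.
Proof.
  set (s := Rabs t); set (E := exp (s / 2)).
  assert (HE : 1 <= E).
  { unfold E; rewrite <- exp_0; apply exp_monotone; unfold s; pose proof (Rabs_pos t); lra. }
  assert (HT : Rabs ((exp (- t / 2) - 1) / (exp (- t / 2) + 1)) = (E - 1) / (E + 1)).
  { assert (P : 0 <= (E - 1) / (E + 1)).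
    { apply Rmult_le_pos; [lra|left; apply Rinv_0_lt_compat; lra]. }
    destruct (Rle_or_lt 0 t) as [H|H].
    - replace (exp (- t / 2)) with (/ E).
      2: { unfold E, s; rewrite Rabs_pos_eq, <- exp_Ropp by easy; f_equal; field. }
      rewrite <- Rabs_Ropp, Rabs_pos_eq; [field; lra|].
      replace (- ((/ E - 1) / (/ E + 1))) with ((E - 1) / (E + 1)); [easy|field; lra].
    - replace (exp (- t / 2)) with E; [now rewrite Rabs_pos_eq|].
      unfold E, s; rewrite Rabs_left by easy; f_equal; field. }
  intros Hb; rewrite HT in Hb.
  assert (Hq : (E - 1) / (E + 1) * (E + 1) = E - 1) by (field; lra).
  assert (Hq1 : (E - 1) / (E + 1) < 1) by nra.
  set (q := (E - 1) / (E + 1)) in *.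
  split; [lra|].
  assert (Hb' : - q <= b <= q) by now apply Rabs_le_between.
  assert (Hr : 0 < (1 + b) / (1 - b)) by (apply Rdiv_lt_0_compat; lra).
  assert (Hr' : (1 + b) / (1 - b) * (1 - b) = 1 + b) by (field; lra).
  set (r := (1 + b) / (1 - b)) in *.
  assert (H1 : r <= E) by nra.
  assert (H2 : / E <= r).
  { apply Rmult_le_reg_l with E; [lra|]; rewrite Rinv_r by lra; nra. }
  assert (L1 : ln r <= s / 2).
  { rewrite <- (ln_exp (s / 2)); fold E; destruct H1 as [H1| ->]; [left; now apply ln_increasing|lra]. }
  assert (L2 : - (s / 2) <= ln r).
  { rewrite <- (ln_exp (- (s / 2))), exp_Ropp; fold E.
    destruct H2 as [H2|H2]; [|rewrite H2; lra].
    left; apply ln_increasing; [apply Rinv_0_lt_compat; lra|easy]. }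
  assert (Rabs (ln r) <= s / 2) by (apply Rabs_le; lra). lra.
Qed.

Theorem theorem2p2 (theta : C -> C)
  (theta_holo : holomorphic_on strip theta)
  (theta_lt1 : forall z : C, strip z -> Cmod (theta z) < 1)
  (theta_real : forall x : R, exists y : R, theta (RtoC x) = RtoC y) :
  exists g1 : R,
    RtoC g1 = g1_coeff theta /\
    0 <= g1 <= 1 /\
    (forall tau : R, tau <> 0 -> theta (RtoC tau) = theta (RtoC 0) ->
       g1 * (1 - g1) <> 0 /\
       Rabs tau >= 2 * Rabs (ln ((1 - g1) / g1))).
Proof.
  assert (Hder : forall z, strip z -> cderiv theta z (C_derive theta z)).
  { intros z Hz; apply is_derive_cderiv, C_derive_correct; auto. }
  destruct (theta_real 0) as [a Ha].
  assert (Ha1 : Rabs a < 1).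
  { rewrite <- Cmod_R, <- Ha; apply theta_lt1, strip_R. }
  assert (Ha2 : 1 - a ^ 2 <> 0).
  { rewrite <- pow2_abs; pose proof (Rabs_pos a); nra. }
  assert (Hl : exists l0 : R, C_derive theta 0 = l0).
  { exists (Re (C_derive theta 0)).
    assert (Hi : Im (C_derive theta 0) = 0).
    { apply (clim_real (fun w => (theta w - theta 0) / (w - 0))%C 0); [|apply Hder, strip_R].
      intros x Hx; destruct (theta_real x) as [y Hy].
      rewrite Hy, Ha, <- !RtoC_minus, <- RtoC_div by lra; apply im_RtoC. }
    destruct (C_derive theta 0) as [u v]; simpl in *; now rewrite Hi. }
  destruct Hl as [l0 Hl0].
  set (F := fun z => ((theta z - a) / (1 - a * theta z))%C).
  (* The derivative of [F] at 0: the factor theta - a vanishes there, so one term of the product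
     rule survives. *)
  set (l := l0 / (1 - a ^ 2)).
  assert (HF : forall z m, strip z -> cderiv theta z m -> cderiv F z
    (m * / (1 - a * theta z) + (theta z - a)
      * - ((- (a * m))%C / ((1 - a * theta z) * (1 - a * theta z))))%C).
  { intros z m Hz Hm.
    pose proof (Mobius_bound a (theta z) Ha1 (theta_lt1 z Hz)) as [Hn _].
    apply (cderiv_mult (fun w => theta w - a)%C (fun w => / (1 - a * theta w))%C).
    - replace m with (m - 0)%C by ring; apply cderiv_minus; [easy|apply cderiv_const].
    - apply (cderiv_inv (fun w => 1 - a * theta w)%C); [easy|].
      replace (- (a * m))%C with (0 - (0 * theta z + a * m))%C by ring.
      apply cderiv_minus; [apply cderiv_const|].
      apply (cderiv_mult (fun _ => RtoC a)); [apply cderiv_const|easy]. }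
  assert (F_holo : holomorphic_in strip F).
  { intros z Hz; eexists; apply HF; [easy|now apply Hder]. }
  assert (F_le1 : forall z, strip z -> Cmod (F z) <= 1).
  { intros z Hz; apply Mobius_bound; auto. }
  assert (Hn0 : (1 - a * a)%C <> 0).
  { rewrite <- RtoC_mult, <- RtoC_minus; intros E; apply RtoC_inj in E; apply Ha2; rewrite <- E; ring. }
  assert (F_0 : forall t : R, theta t = theta 0 -> F t = 0).
  { intros t Ht; unfold F; rewrite Ht, Ha; field; easy. }
  assert (F_deriv : cderiv F 0 l).
  { pose proof (HF 0%C (RtoC l0) (strip_R 0)) as H; rewrite Ha in H.
    replace (RtoC l) with (l0 * / (1 - a * a) + (a - a) *
      - ((- (a * l0)) / ((1 - a * a) * (1 - a * a))))%C.
    - apply H; rewrite <- Hl0; apply Hder, strip_R.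
    - unfold l; rewrite RtoC_div, RtoC_minus, RtoC_pow by easy.
      replace (1 - a ^ 2)%C with (1 - a * a)%C by ring; field; easy. }
  set (b := 4 * l).
  assert (Hb : (l / RtoC (/ 4))%C = b).
  { unfold b; rewrite <- RtoC_div by lra; f_equal; field. }
  pose proof (strip_Schwarz F l F_holo F_le1 (F_0 0 eq_refl) F_deriv) as S1.
  rewrite Hb, Cmod_R in S1; apply Rabs_le_between in S1.
  exists ((1 - b) / 2); split; [|split; [lra|]].
  - unfold g1_coeff; rewrite Ha, Hl0.
    replace ((1 - b) / 2) with (/ 2 * ((1 - 4 * l0 - a ^ 2) / (1 - a ^ 2)))
      by (unfold b, l; field; easy).
    rewrite RtoC_mult, RtoC_div, !RtoC_minus, RtoC_mult, RtoC_inv, RtoC_pow by (easy || lra).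
    reflexivity.
  - intros tau Htau Heq.
    pose proof (strip_Schwarz_two_zeros F l tau F_holo F_le1 (F_0 0 eq_refl) F_deriv Htau
      (F_0 tau Heq)) as S2.
    unfold tanh4_at in S2.
    replace (1 * 0 + - tau)%C with (RtoC (- tau)) in S2 by (rewrite RtoC_opp; ring).
    rewrite Hb, tanh4_R, !Cmod_R in S2.
    destruct (log_ratio_bound b tau S2) as [B1 B2].
    (* Here g_1 (1 - g_1) = (1 - b^2) / 4, which is positive because |b| < 1. *)
    apply Rabs_lt_between in B1; split; [nra|].
    replace ((1 - (1 - b) / 2) / ((1 - b) / 2)) with ((1 + b) / (1 - b)) by (field; lra).
    lra.
Qed.
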